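(* Let $(\Delta,\mathcal S)$ be an ice quiver with potential (satisfying the standing assumptions of the context) and suppose that $(\Delta,\mathcal S)$ is frozen-Jacobi-finite. A $\delta$-vector $\delta$ is $\mu$-supported if and only if $\mathrm{Hom}(\delta,E_i^\star)=0$ for every frozen vertex $i$. Dually, a $\check\delta$-vector $\check\delta$ is $\mu$-supported if and only if $\mathrm{Hom}(E_i,\check\delta)=0$ for every frozen vertex $i$.
   Context: **Quivers with potential.** The ground field $k$ is algebraically closed of characteristic $0$. A quiver $\Delta$ has finite vertex set $\Delta_0$, finitely many arrows, no loops; $B(\Delta)(u,v)=\#\{u\to v\}-\#\{v\to u\}$. A potential $\mathcal S$ is a (possibly infinite) linear combination of oriented cycles up to cyclic equivalence; $J=\widehat{k\Delta}/\partial\mathcal S$ is the Jacobian algebra (completed path algebra modulo the closed ideal generated by the cyclic derivatives). For an ice quiver $\Delta_0=\Delta_0^\mu\sqcup\Delta_0^{\mathrm{fr}}$ (mutable, frozen); $B_\Delta$ is $B(\Delta)$ with the frozen rows deleted. $(\Delta,\mathcal S)$ is nondegenerate if all sequences of Derksen–Weyman–Zelevinsky mutations at mutable vertices are defined. $P_u$, $I_u$ are the indecomposable projective and injective modules at $u$ ($P_u$ spanned by paths starting at $u$; $P_u(v)$ is its component at $v$); $P(\beta)=\bigoplus_u\beta(u)P_u$, $I(\beta)=\bigoplus_u\beta(u)I_u$; $[x]_+=\max(x,0)$ coordinatewise. $(\Delta,\mathcal S)$ is frozen-Jacobi-finite if $P_i(j)$ is finite-dimensional for all $i,j\in\Delta_0^{\mathrm{fr}}$.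 **General presentations.** A $\delta$-vector is a vector $\delta\in\mathbb Z^{\Delta_0}$, regarded as the weight of $\mathrm{PHom}(\delta)=\mathrm{Hom}(P([-\delta]_+),P([\delta]_+))$; a $\check\delta$-vector is a vector $\check\delta\in\mathbb Z^{\Delta_0}$, regarded as the weight of $\mathrm{IHom}(\check\delta)=\mathrm{Hom}(I([\check\delta]_+),I([-\check\delta]_+))$. ''General'' means in a dense open subset. $\delta$ is $\mu$-supported if the cokernel of a general $d\in\mathrm{PHom}(\delta)$ is supported only on $\Delta_0^\mu$; $\check\delta$ is $\mu$-supported if the kernel of a general $\check d\in\mathrm{IHom}(\check\delta)$ is supported only on $\Delta_0^\mu$. $\mathrm{Hom}(\delta,N)=0$ means $\mathrm{Hom}(\mathrm{coker}(d),N)=0$ for general $d\in\mathrm{PHom}(\delta)$ (equivalently, the minimal value of its dimension is $0$); $\mathrm{Hom}(M,\check\delta)=0$ means $\mathrm{Hom}(M,\ker(\check d))=0$ for general $\check d\in\mathrm{IHom}(\check\delta)$. **Boundary representations.** For $i$ frozen let $J_{\mu[i]}$ be the Jacobian algebra of the restriction $(\Delta,\mathcal S)_{\mu[i]}$ of the QP to the full subquiver on $\Delta_0^\mu\cup\{i\}$. $E_i$ (resp. $E_i^\star$) is the indecomposable projective (resp. injective) $J_{\mu[i]}$-module at $i$, extended by zero to $\Delta$. Frozen vertices are not required to be rigid or reachable. **Standing assumptions.** $(\Delta,\mathcal S)$ is nondegenerate, each frozen $i$ is simple in $(\Delta,\mathcal S)_{\mu[i]}$ (for arrows $a:u\to i$,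 $b:i\to w$ there, the derivative $\partial_{[ab]}[\mathcal S]$, where each occurrence of $ab$ in $\mathcal S$ is replaced by a new arrow $[ab]$, involves no arrow incident to $i$), and $d_i=(\partial_{[ab]}[\mathcal S])_{a,b}:\bigoplus_{a:u\to i}P_u\to\bigoplus_{b:i\to w}P_w$ is a general presentation of the restriction to $\Delta_0^\mu$, of weight $-b_i$, $b_i$ the $i$-th column of $B_\Delta$. *)

(* Defs.v *)
From HB Require Import structures.
From mathcomp Require Import all_boot all_order all_algebra.
From mathcomp Require Import generic_quotient ring_quotient.
From mathcomp Require Import boolp functions.

Set Implicit Arguments.
Unset Strict Implicit.
Unset Printing Implicit Defensive.

Import Order.TTheory GRing.Theory Num.Theory.
Local Open Scope ring_scope.
Local Open Scope quotient_scope.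

Record subspace (k : fieldType) (V : lmodType k) := Subspace {
  smem :> V -> Prop;
  smem0 : smem 0;
  smemP : forall (c : k) x y, smem x -> smem y -> smem (c *: x + y) }.

Section Subspace.
Variables (k : fieldType) (V : lmodType k) (N : subspace V).

Definition smemb : {pred V} := fun x => `[< N x >].

Fact smemb_closed : submod_closed smemb.
Proof.
split; first by apply/asboolP; exact: smem0.
by move=> c x y /asboolP Nx /asboolP Ny; apply/asboolP; exact: smemP.
Qed.

HB.instance Definition _ := GRing.isSubmodClosed.Build k V smemb smemb_closed.
Record subsp := SubSp { subsp_val :> V; _ : subsp_val \in smemb }.
HB.instance Definition _ := [isSub for subsp_val].
HB.instance Definition _ := [Choice of subsp by <:].
HB.instance Definition _ := [SubChoice_isSubLmodule of subsp by <:].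

Definition quotsp : Type := Quotient.quot smemb.
HB.instance Definition _ := GRing.Zmodule.on quotsp.

Definition toq (x : V) : quotsp := \pi_(Quotient.quot smemb) x.

Lemma toqE x y : (toq x = toq y) <-> N (x - y).
Proof.
split=> [e|Nxy]; first by apply/asboolP; rewrite -[asbool _]/(x - y \in smemb)
  Quotient.idealrBE; apply/eqP.
by apply/eqP; rewrite /toq -Quotient.idealrBE; apply/asboolP.
Qed.

Lemma toqK (q : quotsp) : toq (repr (q : Quotient.quot smemb)) = q.
Proof. exact: reprK. Qed.

Definition rep (q : quotsp) : V := repr (q : Quotient.quot smemb).

Lemma toqD x y : toq (x + y) = toq x + toq y.
Proof. exact: Quotient.pi_add. Qed.

Definition quotsp_scale (c : k) (q : quotsp) : quotsp := toq (c *: rep q).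

Lemma toqZ c x : toq (c *: x) = quotsp_scale c (toq x).
Proof.
apply/toqE; rewrite -scalerBr -[_ *: _]addr0; apply: smemP (smem0 N).
by apply/toqE; rewrite /rep toqK.
Qed.

Fact quotsp_scaleA a b q :
  quotsp_scale a (quotsp_scale b q) = quotsp_scale (a * b) q.
Proof. by rewrite -[q]toqK -!toqZ scalerA. Qed.

Fact quotsp_scale1 : left_id 1 quotsp_scale.
Proof. by move=> q; rewrite -[q]toqK -!toqZ scale1r. Qed.

Fact quotsp_scaleDr : right_distributive quotsp_scale +%R.
Proof.
by move=> c p q; rewrite -[p]toqK -[q]toqK -!(toqZ, toqD) scalerDr.
Qed.

Fact quotsp_scaleDl q : {morph quotsp_scale^~ q : a b / a + b}.
Proof. by move=> a b; rewrite -[q]toqK -!(toqZ, toqD) scalerDl. Qed.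

HB.instance Definition _ := GRing.Zmodule_isLmodule.Build k quotsp
  quotsp_scaleA quotsp_scale1 quotsp_scaleDr quotsp_scaleDl.

Lemma toq_lin c x y : toq (c *: x + y) = c *: toq x + toq y.
Proof. by rewrite toqD toqZ. Qed.
End Subspace.

Section Product.
Variables (k : fieldType) (I : Type) (M : I -> lmodType k).

Definition prodsp : Type := forall i, M i.
HB.instance Definition _ := Choice.on prodsp.

Implicit Types f g h : prodsp.
Definition prodsp_zero : prodsp := fun=> 0.
Definition prodsp_opp f : prodsp := fun i => - f i.
Definition prodsp_add f g : prodsp := fun i => f i + g i.
Definition prodsp_scale (c : k) f : prodsp := fun i => c *: f i.

Fact prodsp_addA : associative prodsp_add.
Proof. by move=> f g h; apply/functional_extensionality_dep=> i; exact: addrA. Qed.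
Fact prodsp_addC : commutative prodsp_add.
Proof. by move=> f g; apply/functional_extensionality_dep=> i; exact: addrC. Qed.
Fact prodsp_add0 : left_id prodsp_zero prodsp_add.
Proof. by move=> f; apply/functional_extensionality_dep=> i; exact: add0r. Qed.
Fact prodsp_addN : left_inverse prodsp_zero prodsp_opp prodsp_add.
Proof. by move=> f; apply/functional_extensionality_dep=> i; exact: addNr. Qed.
HB.instance Definition _ := GRing.isZmodule.Build prodsp
  prodsp_addA prodsp_addC prodsp_add0 prodsp_addN.

Fact prodsp_scaleA a b f : prodsp_scale a (prodsp_scale b f) = prodsp_scale (a * b) f.
Proof. by apply/functional_extensionality_dep=> i; exact: scalerA. Qed.
Fact prodsp_scale1 : left_id 1 prodsp_scale.
Proof. by move=> f; apply/functional_extensionality_dep=> i; exact: scale1r. Qed.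
Fact prodsp_scaleDr : right_distributive prodsp_scale +%R.
Proof. by move=> c f g; apply/functional_extensionality_dep=> i; exact: scalerDr. Qed.
Fact prodsp_scaleDl f : {morph prodsp_scale^~ f : a b / a + b}.
Proof. by move=> a b; apply/functional_extensionality_dep=> i; exact: scalerDl. Qed.
HB.instance Definition _ := GRing.Zmodule_isLmodule.Build k prodsp
  prodsp_scaleA prodsp_scale1 prodsp_scaleDr prodsp_scaleDl.
End Product.

Record quiver (V : finType) := Quiver { arr :> finType; tl : arr -> V; hd : arr -> V }.

Section PathAlgebra.
Variables (k : fieldType) (V : finType) (Q : quiver V).

Definition loopless := forall a : Q, tl a != hd a.

(* [is_path X u v w]: the word w, read from left to right, is a path from u to
   v in the full subquiver on X.  Working with words of arrows of Q throughout
   makes the restriction of a quiver with potential to X a mere restriction of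
   domains, and extension by zero the identity on vector spaces. *)
Fixpoint is_path (X : {set V}) (u v : V) (w : seq Q) : bool :=
  (u \in X) && (if w is a :: w' then (tl a == u) && is_path X (hd a) v w'
                else u == v).

Definition path_in (X : {set V}) (u v : V) := {w : seq Q | is_path X u v w}.

(* e_u A e_v, where A is the completed path algebra of the full subquiver on
   X: formal infinite linear combinations of paths. *)
Definition cpath (X : {set V}) (u v : V) := path_in X u v -> k^o.

Definition coef (X : {set V}) (u v : V) (f : cpath X u v) (w : seq Q) : k :=
  if insub w is Some p then f p else 0.

Definition conv (f g : seq Q -> k) (w : seq Q) : k :=
  \sum_(t < (size w).+1) f (take t w) * g (drop t w).

Definition cmul (X : {set V}) (u x v : V) (f : cpath X u x) (g : cpath X x v) :
  cpath X u v := fun p => conv (coef f) (coef g) (val p).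

Definition cone (X : {set V}) (u : V) : cpath X u u :=
  fun p => (nilp (val p))%:R.
Arguments cone : clear implicits.

Definition restr (X Y : {set V}) (u v : V) (f : cpath Y u v) : cpath X u v :=
  fun p => coef f (val p).

Lemma is_path_in X u v w : is_path X u v w -> (u \in X) && (v \in X).
Proof.
elim: w u => [|a w IH] u /= /andP[uX]; first by move/eqP=> <-; rewrite uX.
by case/andP=> _ /IH/andP[_ ->]; rewrite uX.
Qed.

Lemma is_path_cat X u v w1 w2 x :
  is_path X u x w1 -> is_path X x v w2 -> is_path X u v (w1 ++ w2).
Proof.
elim: w1 u => [|a w1 IH] u /=; first by case/andP=> _ /eqP->.
by case/andP=> -> /andP[-> p1] p2 /=; exact: IH.
Qed.

Lemma is_pathT X u v w :
  is_path X u v w = is_path [set: V] u v w && ((u \in X) && all (fun a => hd a \in X) w).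
Proof.
elim: w u => [|a w IH] u /=; first by rewrite in_setT andbT andbC.
rewrite IH in_setT /= !andbA; do 2!congr (_ && _).
by rewrite -!andbA andbC -andbA; congr (_ && _); rewrite andbC.
Qed.

Lemma coef_path X u v (f : cpath X u v) w (pw : is_path X u v w) :
  coef f w = f (Sub w pw).
Proof. by rewrite /coef insubT. Qed.

Lemma coef_val X u v (f : cpath X u v) p : coef f (val p) = f p.
Proof. by rewrite /coef valK. Qed.

Lemma coef_nopath X u v (f : cpath X u v) w : ~~ is_path X u v w -> coef f w = 0.
Proof. by move=> np; rewrite /coef insubN. Qed.

Lemma coef_lin X u v c (f g : cpath X u v) w :
  coef (c *: f + g) w = c * coef f w + coef g w.
Proof. by rewrite /coef; case: insub => [p|] //=; rewrite mulr0 addr0. Qed.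

Lemma coef_cmul X u x v (f : cpath X u x) (g : cpath X x v) w :
  coef (cmul f g) w = conv (coef f) (coef g) w.
Proof.
case: (boolP (is_path X u v w)) => [pw|npw]; first by rewrite coef_path.
rewrite coef_nopath // /conv big1 // => t _.
case: (boolP (is_path X u x (take t w))) => [p1|p1]; last first.
  by rewrite coef_nopath // mul0r.
case: (boolP (is_path X x v (drop t w))) => [p2|p2]; last first.
  by rewrite [coef g _]coef_nopath // mulr0.
by case/negP: npw; rewrite -[w](cat_take_drop t); exact: is_path_cat p1 p2.
Qed.

Lemma conv_nil f g : conv f g [::] = f [::] * g [::].
Proof. by rewrite /conv big_ord_recl big_ord0 addr0. Qed.

Lemma conv_cons f g a w :
  conv f g (a :: w) = f [::] * g (a :: w) + conv (fun w' => f (a :: w')) g w.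
Proof. by rewrite /conv big_ord_recl. Qed.

Lemma conv_linl c f1 f2 g w :
  conv (fun x => c * f1 x + f2 x) g w = c * conv f1 g w + conv f2 g w.
Proof.
by rewrite /conv mulr_sumr -big_split; apply: eq_bigr => t _; rewrite mulrDl mulrA.
Qed.

Lemma conv_linr c f g1 g2 w :
  conv f (fun x => c * g1 x + g2 x) w = c * conv f g1 w + conv f g2 w.
Proof.
rewrite /conv mulr_sumr -big_split; apply: eq_bigr => t _.
by rewrite mulrDr mulrCA.
Qed.

Lemma conv_ext f1 f2 g1 g2 : f1 =1 f2 -> g1 =1 g2 -> conv f1 g1 =1 conv f2 g2.
Proof. by move=> e1 e2 w; apply: eq_bigr => t _; rewrite e1 e2. Qed.

Lemma convA f g h w : conv f (conv g h) w = conv (conv f g) h w.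
Proof.
elim: w f g => [|a w IH] f g; first by rewrite !conv_nil mulrA.
rewrite !conv_cons conv_nil mulrDr mulrA -addrA; congr (_ + _).
under [in RHS]conv_ext do [rewrite conv_cons|].
by rewrite conv_linl IH.
Qed.

Lemma cmul_linl X u x v c (f1 f2 : cpath X u x) (g : cpath X x v) :
  cmul (c *: f1 + f2) g = c *: cmul f1 g + cmul f2 g.
Proof.
apply/funext => p; rewrite /cmul; under conv_ext do [rewrite coef_lin|].
exact: conv_linl.
Qed.

Lemma cmul_linr X u x v c (f : cpath X u x) (g1 g2 : cpath X x v) :
  cmul f (c *: g1 + g2) = c *: cmul f g1 + cmul f g2.
Proof.
apply/funext => p; rewrite /cmul; under conv_ext do [|rewrite coef_lin].
exact: conv_linr.
Qed.

Lemma cmulA X u x y v (f : cpath X u x) (g : cpath X x y) (h : cpath X y v) :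
  cmul f (cmul g h) = cmul (cmul f g) h.
Proof.
apply/funext => p; rewrite /cmul.
under conv_ext do [|rewrite coef_cmul].
under [in RHS]conv_ext do [rewrite coef_cmul|].
exact: convA.
Qed.

Lemma cmul1l X u v (f : cpath X u v) : cmul (cone X u) f = f.
Proof.
apply/funext => -[w pw]; rewrite /cmul /conv /= big_ord_recl /= drop0.
have uX : is_path X u u [::] by rewrite /= eqxx andbT; case/andP: (is_path_in pw).
rewrite take0 coef_path mul1r coef_path big1 ?addr0; last first.
  move=> t _; rewrite /coef; case: insubP => [p _ vp|_]; last by rewrite mul0r.
  by rewrite /cone vp /nilp size_takel // mul0r.
by congr f; apply: val_inj.
Qed.

Lemma cmul1r X u v (f : cpath X u v) : cmul f (cone X v) = f.
Proof.
apply/funext => -[w pw]; rewrite /cmul /conv /= big_ord_recr /= drop_size take_size.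
have vX : is_path X v v [::] by rewrite /= eqxx andbT; case/andP: (is_path_in pw).
rewrite (coef_path _ vX) mulr1 coef_path big1 ?add0r; last first.
  move=> t _; rewrite [coef (cone _ _) _]/coef.
  case: insubP => [p _ vp|_]; last by rewrite mulr0.
  rewrite /cone vp /nilp size_drop subn_eq0 leqNgt ltn_ord mulr0 //.
by congr f; apply: val_inj.
Qed.

Lemma cmul0l X u x v (g : cpath X x v) : cmul (0 : cpath X u x) g = 0.
Proof. by have := @cmul_linl X u x v (-1) 0 0 g; rewrite scaleN1r addNr scaleN1r addNr. Qed.

Lemma cmul0r X u x v (f : cpath X u x) : cmul f (0 : cpath X x v) = 0.
Proof. by have := @cmul_linr X u x v (-1) f 0 0; rewrite scaleN1r addNr scaleN1r addNr. Qed.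

Lemma cmulDl X u x v (f1 f2 : cpath X u x) (g : cpath X x v) :
  cmul (f1 + f2) g = cmul f1 g + cmul f2 g.
Proof. by have := cmul_linl 1 f1 f2 g; rewrite !scale1r. Qed.

Lemma cmulDr X u x v (f : cpath X u x) (g1 g2 : cpath X x v) :
  cmul f (g1 + g2) = cmul f g1 + cmul f g2.
Proof. by have := cmul_linr 1 f g1 g2; rewrite !scale1r. Qed.

Lemma cmulZl X u x v c (f : cpath X u x) (g : cpath X x v) :
  cmul (c *: f) g = c *: cmul f g.
Proof. by rewrite -[c *: f]addr0 cmul_linl cmul0l addr0. Qed.

(* The topology of the completed path algebra: f and g are close when they
   agree on all paths of length < n. *)
Definition agree_below X u v (n : nat) (f g : cpath X u v) :=
  forall p, (size (val p) < n)%N -> f p = g p.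

Lemma agree_cmul X u x v n (f f' : cpath X u x) (g g' : cpath X x v) :
  agree_below n f f' -> agree_below n g g' -> agree_below n (cmul f g) (cmul f' g').
Proof.
move=> ef eg p np; apply: eq_bigr => t _; congr (_ * _); rewrite /coef.
  case: insubP => [q _ vq|] //; apply: ef; rewrite vq.
  by apply: leq_ltn_trans np; rewrite size_take_min geq_minr.
case: insubP => [q _ vq|] //; apply: eg; rewrite vq size_drop.
exact: leq_ltn_trans (leq_subr _ _) np.
Qed.

Lemma restr_lin X Y u v c (f g : cpath Y u v) :
  restr (c *: f + g) = c *: restr f + restr g :> cpath X u v.
Proof. by apply/funext => p; rewrite /restr coef_lin. Qed.

Lemma restr_cone X u : restr (cone [set: V] u) = cone X u.
Proof.
apply/funext => -[w pw]; rewrite /restr coef_path //=.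
by move: pw; rewrite is_pathT => /andP[].
Qed.

Lemma restr_cmul X u x v (f : cpath [set: V] u x) (g : cpath [set: V] x v) :
  restr (cmul f g) = cmul (restr f) (restr g) :> cpath X u v.
Proof.
apply/funext => -[w pw]; rewrite /restr coef_cmul /cmul /= /conv.
apply: eq_bigr => t _.
have H y z (h : cpath [set: V] y z) w' : y \in X -> all (fun a => hd a \in X) w' ->
    coef h w' = coef (restr h : cpath X y z) w'.
  move=> yX aX; have e := is_pathT X y z w'; rewrite yX aX !andbT in e.
  case: (boolP (is_path X y z w')) => [p|np]; last by rewrite !coef_nopath // -e.
  by rewrite (coef_path (restr h) p).
move: (pw); rewrite is_pathT => /and3P[_ uX].
rewrite -{1}[w](cat_take_drop t) all_cat => /andP[a1 a2].
rewrite -(H _ _ f) //.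
case: (boolP (is_path X u x (take t w))) => [p1|p1]; last first.
  rewrite [coef f _]coef_nopath ?mul0r //.
  by apply: contra p1 => p1; rewrite is_pathT p1 uX.
by rewrite -(H _ _ g) //; case/andP: (is_path_in p1).
Qed.

(* A potential is given by its coefficients on cyclic words; only its values
   at nonempty closed paths are ever used. *)
Definition potential := seq Q -> k.

Definition rotsum (S : potential) (c : seq Q) : k :=
  \sum_(t < size c) S (rot t c).

(* The closure of the span of the differences of rotations is the common
   kernel of the functionals [rotsum], since these are, up to the nonzero
   integers n / |orbit|, the sums of the coefficients over each cyclic orbit of
   words of length n (characteristic 0). *)
Definition cyc_equiv (X : {set V}) (S T : potential) :=
  forall u w, is_path X u u w -> rotsum S w = rotsum T w.

(* The coefficient of the path p in the cyclic derivative of S at a is the sum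
   of S(c) over all pairs of a cycle c and an occurrence of a in c after which
   c continues cyclically with p. *)
Definition cderiv (X : {set V}) (S : potential) (a : Q) : cpath X (hd a) (tl a) :=
  fun p => rotsum S (a :: val p).
Arguments cderiv : clear implicits.

Inductive jac_alg (X : {set V}) (S : potential) (u v : V) : cpath X u v -> Prop :=
| Jac0 : jac_alg S 0
| JacD f g : jac_alg S f -> jac_alg S g -> jac_alg S (f + g)
| JacM a (x : cpath X u (hd a)) (y : cpath X (tl a) v) :
    jac_alg S (cmul (cmul x (cderiv X S a)) y).

Definition jac_mem (X : {set V}) (S : potential) (u v : V) (f : cpath X u v) :=
  forall n, exists2 g, jac_alg S g & agree_below n f g.

Lemma jac_algZ X S u v c (f : cpath X u v) : jac_alg S f -> jac_alg S (c *: f).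
Proof.
elim=> [|f1 f2 _ j1 _ j2|a x y]; first by rewrite scaler0; exact: Jac0.
  by rewrite scalerDr; exact: JacD.
by rewrite -!cmulZl; exact: JacM.
Qed.

Lemma jac_algMl X S u x v (f : cpath X u x) (g : cpath X x v) :
  jac_alg S g -> jac_alg S (cmul f g).
Proof.
elim=> [|f1 f2 _ j1 _ j2|a y z]; first by rewrite cmul0r; exact: Jac0.
  by rewrite cmulDr; exact: JacD.
by rewrite !cmulA; exact: JacM.
Qed.

Lemma jac_algMr X S u x v (f : cpath X u x) (g : cpath X x v) :
  jac_alg S f -> jac_alg S (cmul f g).
Proof.
elim=> [|f1 f2 _ j1 _ j2|a y z]; first by rewrite cmul0l; exact: Jac0.
  by rewrite cmulDl; exact: JacD.
by rewrite -cmulA; exact: JacM.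
Qed.

Lemma jac_memMl X S u x v (f : cpath X u x) (g : cpath X x v) :
  jac_mem S g -> jac_mem S (cmul f g).
Proof.
move=> j n; have [g' jg' e] := j n; exists (cmul f g'); first exact: jac_algMl.
exact: agree_cmul.
Qed.

Lemma jac_memMr X S u x v (f : cpath X u x) (g : cpath X x v) :
  jac_mem S f -> jac_mem S (cmul f g).
Proof.
move=> j n; have [g' jg' e] := j n; exists (cmul g' g); first exact: jac_algMr.
exact: agree_cmul.
Qed.

Fact jac0 X S u v : jac_mem S (0 : cpath X u v).
Proof. by move=> n; exists 0 => //; exact: Jac0. Qed.

Fact jac_lin X S u v c (f g : cpath X u v) :
  jac_mem S f -> jac_mem S g -> jac_mem S (c *: f + g).
Proof.
move=> jf jg n; have [f' jf' ef] := jf n; have [g' jg' eg] := jg n.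
exists (c *: f' + g'); first by apply: JacD => //; exact: jac_algZ.
move=> p np; rewrite -[LHS]/(c * f p + g p) -[RHS]/(c * f' p + g' p).
by rewrite ef ?eg.
Qed.

(* The component between u and v of the closed Jacobian ideal of the
   restriction of (Q, S) to X, and the Jacobian algebra. *)
Definition jac X S u v : subspace (cpath X u v) :=
  Subspace (@jac0 X S u v) (@jac_lin X S u v).

Definition Jac X S u v := quotsp (jac X S u v).

Lemma jac_alg_restr X S u v (f : cpath [set: V] u v) :
  jac_alg S f -> jac_alg S (restr f : cpath X u v).
Proof.
elim=> [|f1 f2 _ j1 _ j2|a x y].
- have -> : restr (0 : cpath [set: V] u v) = 0 :> cpath X u v; last exact: Jac0.
  by apply/funext => p; rewrite /restr /coef; case: insub.
- have -> : restr (f1 + f2) = restr f1 + restr f2 :> cpath X u v; last exact: JacD.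
  by rewrite -[f1]scale1r restr_lin !scale1r.
rewrite !restr_cmul.
have -> : restr (cderiv [set: V] S a) = cderiv X S a; last exact: JacM.
apply/funext => -[w pw]; rewrite /restr coef_path //=.
by move: pw; rewrite is_pathT => /andP[].
Qed.

Lemma jac_restr X S u v (f : cpath [set: V] u v) :
  jac [set: V] S u v f -> jac X S u v (restr f).
Proof.
move=> j n; have [g jg e] := j n; exists (restr g); first exact: jac_alg_restr.
move=> p np; rewrite /restr /coef; case: insubP => [q _ vq|] //.
by apply: e; rewrite vq.
Qed.

End PathAlgebra.
Arguments cone {k V Q} X u.
Arguments cderiv {k V Q} X S a.

Section Modules.
Variables (k : fieldType) (V : finType) (Q : quiver V).

(* A Jacobian-algebra module M is recorded as the family of the vector spaces
   M(u) with the action M(u) -> M(v) of the whole components e_u A e_v of the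
   completed path algebra A (not only of the arrows), on which the closed
   Jacobian ideal acts as zero. *)
Record jmod (X : {set V}) (S : potential k Q) := JMod {
  mcar :> V -> lmodType k;
  act : forall u v, cpath k Q X u v -> mcar u -> mcar v;
  act_linear : forall u v (f : cpath k Q X u v), linear (act f);
  act_linl : forall u v c (f g : cpath k Q X u v) m,
    act (c *: f + g) m = c *: act f m + act g m;
  act_one : forall u (m : mcar u), act (cone X u) m = m;
  act_mul : forall u x v (f : cpath k Q X u x) (g : cpath k Q X x v) m,
    act (cmul f g) m = act g (act f m);
  act_jac : forall u v (f : cpath k Q X u v) m, jac X S u v f -> act f m = 0 }.

Record jhom (X : {set V}) (S : potential k Q) (M N : jmod X S) := JHom {
  hfun :> forall u, M u -> N u;
  hlinear : forall u, linear (hfun (u := u));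
  hact : forall u v (f : cpath k Q X u v) (m : M u),
    hfun (act f m) = act f (hfun m) }.

Definition hom_zero X S (M N : jmod X S) :=
  forall (h : jhom M N) u (m : M u), h u m = 0.

Section Constructions.
Variables (X : {set V}) (S : potential k Q).

Definition jact u v w (q : Jac X S u v) (f : cpath k Q X v w) : Jac X S u w :=
  toq (jac X S u w) (cmul (rep q) f).

Definition ljact u v w (f : cpath k Q X u v) (q : Jac X S v w) : Jac X S u w :=
  toq (jac X S u w) (cmul f (rep q)).

Lemma jac_rep u v (g : cpath k Q X u v) :
  jac_mem S (rep (toq (jac X S u v) g) - g).
Proof. by apply: (proj1 (toqE (jac X S u v) _ _)); rewrite toqK. Qed.

Lemma jactE u v w (g : cpath k Q X u v) (f : cpath k Q X v w) :
  jact (toq (jac X S u v) g) f = toq (jac X S u w) (cmul g f).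
Proof.
apply/toqE; rewrite -[- cmul g f]scaleN1r -cmulZl -cmulDl scaleN1r.
by apply: jac_memMr; exact: jac_rep.
Qed.

Lemma ljactE u v w (f : cpath k Q X u v) (g : cpath k Q X v w) :
  ljact f (toq (jac X S v w) g) = toq (jac X S u w) (cmul f g).
Proof.
apply/toqE; rewrite -[- cmul f g]scaleN1r.
have -> : -1 *: cmul f g = cmul f (-1 *: g).
  by rewrite -[-1 *: g]addr0 cmul_linr cmul0r addr0.
rewrite -cmulDr scaleN1r.
by apply: jac_memMl; exact: jac_rep.
Qed.

Lemma ljact_linear u v w (f : cpath k Q X u v) : linear (@ljact u v w f).
Proof.
move=> c p q; rewrite -[p]toqK -[q]toqK -toq_lin !ljactE -toq_lin.
by rewrite cmul_linr.
Qed.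

Lemma ljact_linl u v w c (f g : cpath k Q X u v) (q : Jac X S v w) :
  ljact (c *: f + g) q = c *: ljact f q + ljact g q.
Proof. by rewrite -[q]toqK !ljactE -toq_lin cmul_linl. Qed.

Lemma ljact_mul u x v w (f : cpath k Q X u x) (g : cpath k Q X x v) (q : Jac X S v w) :
  ljact (cmul f g) q = ljact f (ljact g q).
Proof. by rewrite -[q]toqK !ljactE cmulA. Qed.

Lemma ljact_jact u v w x (f : cpath k Q X u v) (q : Jac X S v w) (g : cpath k Q X w x) :
  ljact f (jact q g) = jact (ljact f q) g.
Proof. by rewrite -[q]toqK ljactE !jactE ljactE cmulA. Qed.

Fact proj_linear u v w (f : cpath k Q X v w) : linear (fun q : Jac X S u v => jact q f).
Proof.
by move=> c p q; rewrite -[p]toqK -[q]toqK -toq_lin !jactE -toq_lin cmul_linl.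
Qed.

Fact proj_linl u v w c (f g : cpath k Q X v w) (q : Jac X S u v) :
  jact q (c *: f + g) = c *: jact q f + jact q g.
Proof. by rewrite -[q]toqK !jactE -toq_lin cmul_linr. Qed.

Fact proj_one u v (q : Jac X S u v) : jact q (cone X v) = q.
Proof. by rewrite -[q]toqK jactE cmul1r. Qed.

Fact proj_mul u v x w (f : cpath k Q X v x) (g : cpath k Q X x w) (q : Jac X S u v) :
  jact q (cmul f g) = jact (jact q f) g.
Proof. by rewrite -[q]toqK !jactE cmulA. Qed.

Lemma toq0P u v (f : cpath k Q X u v) : jac X S u v f -> toq (jac X S u v) f = 0.
Proof.
move=> jf; apply: (@addrI _ (toq (jac X S u v) 0)); rewrite -toqD addr0 add0r.
by apply/toqE; rewrite subr0.
Qed.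

Fact proj_jac u v w (f : cpath k Q X v w) (q : Jac X S u v) :
  jac X S v w f -> jact q f = 0.
Proof. by move=> jf; apply: toq0P; exact: jac_memMl. Qed.

(* P_u(v) = e_u J e_v *)
Definition proj_mod (u : V) : jmod X S :=
  @JMod X S (fun v => Jac X S u v) (fun v w f q => jact q f)
    (@proj_linear u) (@proj_linl u) (@proj_one u) (@proj_mul u) (@proj_jac u).

(* The continuous dual of e_v J e_u. *)
Definition cdual_mem v u (xi : Jac X S v u -> k^o) :=
  linear xi /\
  exists n, forall g : cpath k Q X v u, agree_below n g 0 ->
    xi (toq (jac X S v u) g) = 0.

Fact cdual0 v u : cdual_mem (0 : Jac X S v u -> k^o).
Proof.
split; last by exists 0%N.
by move=> c x y; rewrite -![(0 : _ -> _) _]/(0 : k^o) scaler0 addr0.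
Qed.

Fact cdual_lin v u c (xi eta : Jac X S v u -> k^o) :
  cdual_mem xi -> cdual_mem eta -> cdual_mem (c *: xi + eta).
Proof.
move=> [lx [n nx]] [le [m me]]; split.
  move=> a x y.
  have E z : (c *: xi + eta) z = c *: xi z + eta z by [].
  rewrite !E lx le !scalerDr !scalerA mulrC addrACA //.
exists (maxn n m) => g ag.
have -> : forall z, (c *: xi + eta) z = c *: xi z + eta z by [].
rewrite nx ?me ?scaler0 ?addr0 //.
  by move=> p pm; apply: ag; rewrite leq_max pm orbT.
by move=> p pn; apply: ag; rewrite leq_max pn.
Qed.

Definition cdual v u : subspace (Jac X S v u -> k^o) :=
  Subspace (@cdual0 v u) (@cdual_lin v u).

Lemma cdualP v u (xi : subsp (cdual v u)) : cdual_mem (subsp_val xi).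
Proof. by case: xi => xi /= /asboolP. Qed.

Fact cdual_act_mem u v w (f : cpath k Q X v w) (xi : subsp (cdual v u)) :
  cdual_mem (fun q : Jac X S w u => subsp_val xi (ljact f q)).
Proof.
have [lx [n nx]] := cdualP xi; split.
  by move=> c p q; rewrite ljact_linear lx.
exists n => g ag; rewrite ljactE; apply: nx.
by rewrite -(@cmul0r _ _ _ X v w u f); exact: agree_cmul.
Qed.

Fact cdual_act_memb u v w (f : cpath k Q X v w) (xi : subsp (cdual v u)) :
  (fun q : Jac X S w u => subsp_val xi (ljact f q)) \in smemb (cdual w u).
Proof. apply/asboolP; exact: cdual_act_mem. Qed.

Definition inj_act u v w (f : cpath k Q X v w) (xi : subsp (cdual v u)) :
  subsp (cdual w u) := SubSp (cdual_act_memb f xi).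

Fact inj_linear u v w (f : cpath k Q X v w) : linear (@inj_act u v w f).
Proof. by move=> c x y; apply: val_inj. Qed.

Fact inj_linl u v w c (f g : cpath k Q X v w) (xi : subsp (cdual v u)) :
  inj_act (c *: f + g) xi = c *: inj_act f xi + inj_act g xi.
Proof.
apply: val_inj; apply/funext => q /=; have [lx _] := cdualP xi.
by rewrite ljact_linl lx.
Qed.

Fact inj_one u v (xi : subsp (cdual v u)) : inj_act (cone X v) xi = xi.
Proof.
apply: val_inj; apply/funext => q /=; congr (subsp_val xi _).
by rewrite -[q]toqK ljactE cmul1l.
Qed.

Fact inj_mul u v x w (f : cpath k Q X v x) (g : cpath k Q X x w) (xi : subsp (cdual v u)) :
  inj_act (cmul f g) xi = inj_act g (inj_act f xi).
Proof. by apply: val_inj; apply/funext => q /=; rewrite ljact_mul. Qed.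

Fact inj_jac u v w (f : cpath k Q X v w) (xi : subsp (cdual v u)) :
  jac X S v w f -> inj_act f xi = 0.
Proof.
move=> jf; apply: val_inj; apply/funext => q /=; have [lx _] := cdualP xi.
have -> : ljact f q = 0 by apply: toq0P; exact: jac_memMr.
by have := lx (-1) 0 0; rewrite !scaleN1r !addNr.
Qed.

(* The injective hull of the simple module at u among locally nilpotent
   modules: I_u(v) is the continuous dual of e_v J e_u (the full dual when
   this is finite-dimensional). *)
Definition inj_mod (u : V) : jmod X S :=
  @JMod X S (fun v => subsp (cdual v u)) (@inj_act u)
    (@inj_linear u) (@inj_linl u) (@inj_one u) (@inj_mul u) (@inj_jac u).

Section DirectSum.
Variables (I : finType) (M : I -> jmod X S).

Definition dsum_car (v : V) : lmodType k := prodsp (fun i => M i v).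
Definition dsum_act u v (f : cpath k Q X u v) (m : dsum_car u) : dsum_car v :=
  fun i => act f (m i).

Fact dsum_linear u v (f : cpath k Q X u v) : linear (dsum_act f).
Proof.
move=> c x y; apply/functional_extensionality_dep => i.
exact: act_linear.
Qed.
Fact dsum_linl u v c (f g : cpath k Q X u v) (m : dsum_car u) :
  dsum_act (c *: f + g) m = c *: dsum_act f m + dsum_act g m.
Proof. apply/functional_extensionality_dep => i; exact: act_linl. Qed.
Fact dsum_one u (m : dsum_car u) : dsum_act (cone X u) m = m.
Proof. apply/functional_extensionality_dep => i; exact: act_one. Qed.
Fact dsum_mul u x v (f : cpath k Q X u x) (g : cpath k Q X x v) (m : dsum_car u) :
  dsum_act (cmul f g) m = dsum_act g (dsum_act f m).
Proof. apply/functional_extensionality_dep => i; exact: act_mul. Qed.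
Fact dsum_jac u v (f : cpath k Q X u v) (m : dsum_car u) :
  jac X S u v f -> dsum_act f m = 0.
Proof. move=> jf; apply/functional_extensionality_dep => i; exact: act_jac. Qed.

Definition dsum : jmod X S := JMod dsum_linear dsum_linl dsum_one dsum_mul dsum_jac.
End DirectSum.

Section KerCoker.
Variables (M N : jmod X S) (d : jhom M N).

Definition im_mem v (n : N v) := exists m, n = d v m.
Fact im0 v : im_mem (0 : N v).
Proof.
exists 0; have := @hlinear _ _ _ _ d v (-1) 0 0.
by rewrite !scaleN1r !addNr.
Qed.
Fact im_lin v c (x y : N v) : im_mem x -> im_mem y -> im_mem (c *: x + y).
Proof. by move=> [m ->] [n ->]; exists (c *: m + n); rewrite hlinear. Qed.
Definition im v : subspace (N v) := Subspace (im0 v) (@im_lin v).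

Definition coker_act u v (f : cpath k Q X u v) (q : quotsp (im u)) : quotsp (im v) :=
  toq (im v) (act f (rep q)).

Lemma act_sub u v (f : cpath k Q X u v) (x y : N u) :
  act f x - act f y = act f (x - y).
Proof.
by rewrite -!scaleN1r addrC -act_linear addrC.
Qed.

Lemma coker_actE u v (f : cpath k Q X u v) n :
  coker_act f (toq (im u) n) = toq (im v) (act f n).
Proof.
apply/toqE; rewrite act_sub.
have /toqE [m ->] := toqK (toq (im u) n).
by exists (act f m); rewrite hact.
Qed.

Fact coker_linear u v (f : cpath k Q X u v) : linear (coker_act f).
Proof.
move=> c p q; rewrite -[p]toqK -[q]toqK -toq_lin !coker_actE -toq_lin.
by rewrite act_linear.
Qed.
Fact coker_linl u v c (f g : cpath k Q X u v) (q : quotsp (im u)) :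
  coker_act (c *: f + g) q = c *: coker_act f q + coker_act g q.
Proof. by rewrite -[q]toqK !coker_actE -toq_lin act_linl. Qed.
Fact coker_one u (q : quotsp (im u)) : coker_act (cone X u) q = q.
Proof. by rewrite -[q]toqK coker_actE act_one. Qed.
Fact coker_mul u x v (f : cpath k Q X u x) (g : cpath k Q X x v) (q : quotsp (im u)) :
  coker_act (cmul f g) q = coker_act g (coker_act f q).
Proof. by rewrite -[q]toqK !coker_actE act_mul. Qed.
Fact coker_jac u v (f : cpath k Q X u v) (q : quotsp (im u)) :
  jac X S u v f -> coker_act f q = 0.
Proof.
move=> jf; rewrite /coker_act act_jac //.
by apply: (addrI (toq (im v) 0)); rewrite -toqD !addr0.
Qed.

Definition coker : jmod X S :=
  @JMod X S (fun v => quotsp (im v)) coker_act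
    coker_linear coker_linl coker_one coker_mul coker_jac.

Definition ker_mem v (m : M v) := d v m = 0.
Fact ker0 v : ker_mem (0 : M v).
Proof.
rewrite /ker_mem; have := @hlinear _ _ _ _ d v (-1) 0 0.
by rewrite !scaleN1r !addNr.
Qed.
Fact ker_lin v c (x y : M v) : ker_mem x -> ker_mem y -> ker_mem (c *: x + y).
Proof.
by rewrite /ker_mem => dx dy; rewrite hlinear dx dy scaler0 addr0.
Qed.
Definition kers v : subspace (M v) := Subspace (ker0 v) (@ker_lin v).

Fact ker_act_mem u v (f : cpath k Q X u v) (m : subsp (kers u)) :
  act f (subsp_val m) \in smemb (kers v).
Proof.
apply/asboolP; rewrite /= /ker_mem hact; case: m => m /= /asboolP ->.
have := @act_linear _ _ N _ _ f (-1) 0 0.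
by rewrite !scaleN1r !addNr.
Qed.
Definition ker_act u v (f : cpath k Q X u v) (m : subsp (kers u)) : subsp (kers v) :=
  SubSp (ker_act_mem f m).

Fact ker_linear u v (f : cpath k Q X u v) : linear (ker_act f).
Proof. by move=> c x y; apply: val_inj; rewrite /= act_linear. Qed.
Fact ker_linl u v c (f g : cpath k Q X u v) (m : subsp (kers u)) :
  ker_act (c *: f + g) m = c *: ker_act f m + ker_act g m.
Proof. by apply: val_inj; rewrite /= act_linl. Qed.
Fact ker_one u (m : subsp (kers u)) : ker_act (cone X u) m = m.
Proof. by apply: val_inj; rewrite /= act_one. Qed.
Fact ker_mul u x v (f : cpath k Q X u x) (g : cpath k Q X x v) (m : subsp (kers u)) :
  ker_act (cmul f g) m = ker_act g (ker_act f m).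
Proof. by apply: val_inj; rewrite /= act_mul. Qed.
Fact ker_jac u v (f : cpath k Q X u v) (m : subsp (kers u)) :
  jac X S u v f -> ker_act f m = 0.
Proof. by move=> jf; apply: val_inj; rewrite /= act_jac. Qed.

Definition ker : jmod X S :=
  @JMod X S (fun v => subsp (kers v)) ker_act
    ker_linear ker_linl ker_one ker_mul ker_jac.
End KerCoker.

(* Left multiplication by a matrix with entries in e_{t(y)} A e_{s(x)}. *)
Section MatrixHom.
Variables (I I' : finType) (s : I -> V) (t : I' -> V).
Variable D : forall (y : I') (x : I), cpath k Q X (t y) (s x).
Arguments D : clear implicits.

Definition mx_fun v (m : dsum (fun x => proj_mod (s x)) v) :
  dsum (fun y => proj_mod (t y)) v :=
  fun y => \sum_x (ljact (D y x) (m x) : Jac X S (t y) v).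

Fact mx_linear v : linear (@mx_fun v).
Proof.
move=> c m n; apply/functional_extensionality_dep => y.
rewrite -[RHS]/(c *: (\sum_x ljact (D y x) (m x)) + \sum_x ljact (D y x) (n x)).
rewrite scaler_sumr -big_split /=; apply: eq_bigr => x _.
exact: ljact_linear.
Qed.

Fact mx_act u v (f : cpath k Q X u v) (m : dsum (fun x => proj_mod (s x)) u) :
  mx_fun (act f m) = act f (mx_fun m).
Proof.
apply/functional_extensionality_dep => y.
rewrite -[RHS]/(jact (\sum_x ljact (D y x) (m x)) f).
have jact_sum (r : seq I) (F : I -> Jac X S (t y) u) :
    jact (\sum_(x <- r) F x) f = \sum_(x <- r) jact (F x) f.
  elim: r => [|x r IH]; last first.
    by rewrite !big_cons -IH -[F x]scale1r proj_linear !scale1r.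
  rewrite !big_nil; have := proj_linear f (-1) (0 : Jac X S (t y) u) 0.
  by rewrite !scaleN1r !addNr.
by rewrite jact_sum; apply: eq_bigr => x _; exact: ljact_jact.
Qed.

Definition mx_hom : jhom (dsum (fun x => proj_mod (s x)))
                         (dsum (fun y => proj_mod (t y))) :=
  JHom mx_linear mx_act.
End MatrixHom.

End Constructions.

Section ExtensionByZero.
Variables (X : {set V}) (S : potential k Q) (M : jmod X S).

Definition ext_act u v (f : cpath k Q [set: V] u v) (m : M u) : M v :=
  act (restr f) m.
Fact ext_linear u v (f : cpath k Q [set: V] u v) : linear (ext_act f).
Proof. exact: act_linear. Qed.
Fact ext_linl u v c (f g : cpath k Q [set: V] u v) m :
  ext_act (c *: f + g) m = c *: ext_act f m + ext_act g m.
Proof. by rewrite /ext_act restr_lin act_linl. Qed.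
Fact ext_one u (m : M u) : ext_act (cone [set: V] u) m = m.
Proof. by rewrite /ext_act restr_cone act_one. Qed.
Fact ext_mul u x v (f : cpath k Q [set: V] u x) (g : cpath k Q [set: V] x v) m :
  ext_act (cmul f g) m = ext_act g (ext_act f m).
Proof. by rewrite /ext_act restr_cmul act_mul. Qed.
Fact ext_jac u v (f : cpath k Q [set: V] u v) m :
  jac [set: V] S u v f -> ext_act f m = 0.
Proof. by move=> jf; apply: act_jac; exact: jac_restr. Qed.

(* Since M(v) = 0 for v outside X (the idempotent at v is 0 there), this is
   the extension of M by zero. *)
Definition ext0 : jmod [set: V] S :=
  JMod ext_linear ext_linl ext_one ext_mul ext_jac.
End ExtensionByZero.

End Modules.

Section Zariski.
Variables (k : fieldType) (V : finType) (Q : quiver V).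
Variables (X : {set V}) (S : potential k Q) (M N : jmod X S).

(* Hom(M, N) may be infinite-dimensional.  Its regular functions are the
   polynomials in the coordinates d |-> xi (d m), where m runs over M and xi
   over a prescribed class F of linear forms on N: the continuous ones when N
   is a sum of projectives, all of them when N is a sum of (discrete)
   injectives.  In both cases Hom(M, N) is a product of components of J, and
   the coordinates are its continuous linear forms; in the finite-dimensional
   case this gives the usual Zariski topology. *)
Variable F : forall v, (N v -> k^o) -> Prop.

Inductive regular_fun : (jhom M N -> k) -> Prop :=
| RegC c : regular_fun (fun=> c)
| RegX v (m : M v) xi : F xi -> regular_fun (fun d => xi (d v m))
| RegD f g : regular_fun f -> regular_fun g -> regular_fun (fun d => f d + g d)
| RegM f g : regular_fun f -> regular_fun g -> regular_fun (fun d => f d * g d).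

Definition zopen (U : jhom M N -> Prop) :=
  forall d, U d ->
  exists f, [/\ regular_fun f, f d <> 0 & forall d', f d' <> 0 -> U d'].

Definition zdense (U : jhom M N -> Prop) :=
  forall W, zopen W -> (exists d, W d) -> exists2 d, U d & W d.

Definition dense_open (U : jhom M N -> Prop) := zopen U /\ zdense U.

Definition general (P : jhom M N -> Prop) :=
  exists2 U, dense_open U & forall d, U d -> P d.
End Zariski.

Section Presentations.
Variables (k : fieldType) (V : finType) (Q : quiver V).
Variables (X : {set V}) (S : potential k Q).

Definition pos_part (x : V -> int) (u : V) : nat := `|Num.max (x u) 0|%N.
Definition opp_vec (x : V -> int) (u : V) : int := - x u.

Definition copies (beta : V -> nat) : finType := {u : V & 'I_(beta u)}.

Definition Pmod (beta : V -> nat) : jmod X S :=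
  dsum (fun x : copies beta => proj_mod X S (tag x)).
Definition Imod (beta : V -> nat) : jmod X S :=
  dsum (fun x : copies beta => inj_mod X S (tag x)).

Definition PHom (delta : V -> int) :=
  jhom (Pmod (pos_part (opp_vec delta))) (Pmod (pos_part delta)).
Definition IHom (delta : V -> int) :=
  jhom (Imod (pos_part delta)) (Imod (pos_part (opp_vec delta))).

Definition Pcont beta v (xi : Pmod beta v -> k^o) :=
  linear xi /\
  exists n, forall m : Pmod beta v,
    (forall x, exists2 g, agree_below n g 0 & m x = toq (jac X S (tag x) v) g) ->
    xi m = 0.

Definition Ilin beta v (xi : Imod beta v -> k^o) := linear xi.

Definition dense_openP delta (U : PHom delta -> Prop) :=
  dense_open (@Pcont (pos_part delta)) U.
Definition generalP delta (P : PHom delta -> Prop) :=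
  general (@Pcont (pos_part delta)) P.
Definition generalI delta (P : IHom delta -> Prop) :=
  general (@Ilin (pos_part (opp_vec delta))) P.
End Presentations.

Section Mutation.
Variables (k : fieldType) (V : finType).

Record qp := QP { qp_quiver :> quiver V; qp_pot : potential k qp_quiver }.
Arguments qp_pot : clear implicits.

(* Such a Phi is automatically continuous, being an isomorphism of algebras
   that fixes the vertices. *)
Record path_alg_iso (Q Q' : quiver V)
    (Phi : forall u v, cpath k Q [set: V] u v -> cpath k Q' [set: V] u v) : Prop := {
  iso_linear : forall u v, linear (Phi u v);
  iso_one : forall u, Phi u u (cone [set: V] u) = cone [set: V] u;
  iso_mul : forall u x v (f : cpath k Q [set: V] u x) (g : cpath k Q [set: V] x v),
    Phi u v (cmul f g) = cmul (Phi u x f) (Phi x v g);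
  iso_bij : forall u v, bijective (Phi u v) }.

Definition pot_at (Q : quiver V) (S : potential k Q) (u : V) :
  cpath k Q [set: V] u u := fun p => if nilp (val p) then 0 else S (val p).
Arguments pot_at : clear implicits.

Definition pot_image (Q Q' : quiver V)
    (Phi : forall u v, cpath k Q [set: V] u v -> cpath k Q' [set: V] u v)
    (S : potential k Q) : potential k Q' :=
  fun w => \sum_u coef (Phi u u (pot_at Q S u)) w.

Definition right_equiv (A B : qp) :=
  exists2 Phi, path_alg_iso Phi &
    cyc_equiv [set: V] (pot_image Phi (qp_pot A)) (qp_pot B).

Definition sum_quiver (Q C : quiver V) : quiver V :=
  @Quiver V (Q + C)%type
    (fun x => match x with inl a => tl a | inr c => tl c end)
    (fun x => match x with inl a => hd a | inr c => hd c end).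

Definition sum_pot (Q C : quiver V) (S : potential k Q) (T : potential k C) :
  potential k (sum_quiver Q C) :=
  fun w : seq (Q + C) =>
    let l := pmap (fun x => if x is inl a then Some a else None) w in
    let r := pmap (fun x => if x is inr c then Some c else None) w in
    if nilp r then S l else if nilp l then T r else 0.

Definition sum_qp (A C : qp) : qp := QP (sum_pot (qp_pot A) (qp_pot C)).

Definition reduced_qp (A : qp) :=
  forall u (w : seq A), is_path [set: V] u u w -> (size w <= 2)%N ->
    rotsum (qp_pot A) w = 0.

(* The potential is homogeneous of degree 2 and its cyclic derivatives span
   the space of arrows. *)
Definition trivial_qp (C : qp) :=
  (forall w : seq C, size w != 2%N -> qp_pot C w = 0) /\
  forall b : C, exists c : C -> k, forall b',
    \sum_a c a * coef (cderiv [set: V] (qp_pot C) a) [:: b'] = (b' == b)%:R.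

Section Premutation.
Variables (m : V) (Q : quiver V).

Definition incident (a : Q) := (tl a == m) || (hd a == m).

(* [inl c] stands for c, or for the reversed arrow c* if c is incident to m;
   [inr (a, b)] stands for the composite arrow [ab] of a : u -> m and
   b : m -> w. *)
Definition premut_arrow (x : Q + Q * Q) :=
  if x is inr (a, b) then (hd a == m) && (tl b == m) else true.

Definition premut_tl (x : Q + Q * Q) : V :=
  match x with
  | inl c => if incident c then hd c else tl c
  | inr (a, b) => tl a
  end.
Definition premut_hd (x : Q + Q * Q) : V :=
  match x with
  | inl c => if incident c then tl c else hd c
  | inr (a, b) => hd b
  end.

Definition premut_quiver : quiver V :=
  @Quiver V {x : Q + Q * Q | premut_arrow x}
    (fun x => premut_tl (val x)) (fun x => premut_hd (val x)).

Definition reversed (x : Q + Q * Q) := if x is inl c then incident c else false.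
Definition expand (x : Q + Q * Q) : seq Q :=
  match x with inl c => [:: c] | inr (a, b) => [:: a; b] end.

(* [S] + sum of the [ab] b* a*, for S without terms based at m. *)
Definition premut_pot (S : potential k Q) : potential k premut_quiver :=
  fun w => let w' := map val w in
    (if has reversed w' then 0 else S (flatten (map expand w'))) +
    (if w' is [:: inr (a, b); inl b'; inl a'] then ((b' == b) && (a' == a))%:R
     else 0).
End Premutation.
Arguments premut_pot m {Q} S w.

Definition no_2cycle_at (m : V) (Q : quiver V) :=
  forall a b : Q, tl a = m -> hd b = m -> hd a <> tl b.

Definition premut_qp (m : V) (A : qp) (S : potential k A) : qp :=
  QP (premut_pot m S).

(* B is a mutation of A at m: the reduced part, which is unique up to right
   equivalence, of the premutation of A at m. *)
Definition mutation (m : V) (A B : qp) :=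
  exists S : potential k A,
  [/\ cyc_equiv [set: V] (qp_pot A) S,
      forall w, is_path [set: V] m m w -> S w = 0,
      reduced_qp B
    & exists2 C, trivial_qp C & right_equiv (premut_qp m S) (sum_qp B C)].

Inductive mutation_reachable (fr : {set V}) (A : qp) : qp -> Prop :=
| ReachRefl : mutation_reachable fr A A
| ReachStep m B C : mutation_reachable fr A B -> m \notin fr ->
    no_2cycle_at m B -> mutation m B C -> mutation_reachable fr A C.

(* The mutation at m is defined when there is no oriented 2-cycle (or loop)
   through m. *)
Definition nondegenerate_qp (fr : {set V}) (A : qp) :=
  forall B, mutation_reachable fr A B -> forall m, m \notin fr -> no_2cycle_at m B.
End Mutation.
Arguments qp_pot {k V} A : rename.

Section IceQuiver.
Variables (k : fieldType) (V : finType) (Q : quiver V) (fr : {set V}).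

Definition mu : {set V} := ~: fr.
Definition mu_with (i : V) : {set V} := i |: ~: fr.

Definition Bmx (u v : V) : int :=
  #|[set a : Q | (tl a == u) && (hd a == v)]|%:Z -
  #|[set a : Q | (tl a == v) && (hd a == u)]|%:Z.

(* The i-th column of B_Q, extended by zero to the frozen vertices. *)
Definition bcol (i u : V) : int := if u \in fr then 0 else Bmx u i.

Definition Emod (S : potential k Q) (i : V) : jmod [set: V] S :=
  ext0 (proj_mod (mu_with i) S i).
Definition Emod_star (S : potential k Q) (i : V) : jmod [set: V] S :=
  ext0 (inj_mod (mu_with i) S i).

(* rotsum S (a :: b :: p) is the coefficient of p in the derivative of [S] by
   [ab], where the new arrows are expanded back to the products they replace.
   In particular, a term in which ab occurs twice counts as incident to i. *)
Definition simple_frozen (S : potential k Q) (i : V) :=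
  forall (a b : Q) (p : seq Q), hd a = i -> tl b = i ->
    is_path (mu_with i) (hd b) (tl a) p -> rotsum S (a :: b :: p) <> 0 ->
    all (fun c => (tl c != i) && (hd c != i)) p.

Definition d_entry (S : potential k Q) (a b : Q) (u v : V) : cpath k Q mu u v :=
  fun p => rotsum S (a :: b :: val p).
Arguments d_entry : clear implicits.

Definition enumerates (beta : V -> nat) (A : pred Q) (e : Q -> V)
    (sigma : copies beta -> Q) :=
  [/\ injective sigma, forall a, A a <-> exists x, sigma x = a
    & forall x, e (sigma x) = tag x].

(* d is d_i, seen as a presentation of weight -b_i: its domain P([b_i]_+) and
   codomain P([-b_i]_+) are the sums over the arrows from mutable vertices to i
   and from i to mutable vertices, which forces the absence of 2-cycles at i
   through mutable vertices.  The Jacobian algebra of the mutable part is that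
   of T, a potential cyclically equivalent there to S. *)
Definition is_frozen_pres (S T : potential k Q) (i : V)
    (d : PHom mu T (opp_vec (bcol i))) :=
  exists sigma tau,
  [/\ enumerates (fun a => (hd a == i) && (tl a \in mu)) (@tl V Q) sigma,
      enumerates (fun b => (tl b == i) && (hd b \in mu)) (@hd V Q) tau
    & forall v m, d v m =
        mx_hom T (fun y x => d_entry S (sigma x) (tau y) (tag y) (tag x)) v m].

Section FixPotential.
Variable S : potential k Q.

Definition supported_on_mu (M : jmod [set: V] S) :=
  forall i, i \in fr -> forall m : M i, m = 0.

Definition mu_supported (delta : V -> int) :=
  generalP (fun d : PHom [set: V] S delta => supported_on_mu (coker d)).
Definition mu_supported_check (delta : V -> int) :=
  generalI (fun d : IHom [set: V] S delta => supported_on_mu (ker d)).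

Definition hom_delta_zero (delta : V -> int) (N : jmod [set: V] S) :=
  generalP (fun d : PHom [set: V] S delta => hom_zero (coker d) N).
Definition hom_check_zero (M : jmod [set: V] S) (delta : V -> int) :=
  generalI (fun d : IHom [set: V] S delta => hom_zero M (ker d)).

Definition findim (W : lmodType k) :=
  exists n (b : 'I_n -> W), forall w, exists c : 'I_n -> k, w = \sum_l c l *: b l.

Definition frozen_Jacobi_finite :=
  forall i j, i \in fr -> j \in fr -> findim (proj_mod [set: V] S i j).
End FixPotential.
End IceQuiver.

(* Main.v *)
Require Import Defs.
From mathcomp Require Import all_boot all_order all_algebra.
From mathcomp Require Import boolp functions.
From mathcomp Require classical_sets.

Set Implicit Arguments.
Unset Strict Implicit.
Unset Printing Implicit Defensive.

Import Order.TTheory GRing.Theory Num.Theory.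
Local Open Scope ring_scope.

(** Both equivalences hold for each presentation [d], and genericity enters only
  through the fact that a finite intersection of dense open sets is dense open
  ([general_forall]).  For one presentation the argument is about modules.

  If [M] vanishes at the frozen vertices, then every map from [M] to [Emod_star i]
  is zero, since a nonzero submodule of [Emod_star i] meets its component at [i],
  and every map from [Emod i] to [M] is zero, since [Emod i] is generated there.

  Conversely, let the kernel [K] of a map between sums of injectives be nonzero at
  some frozen vertex.  The elements of an injective are continuous functionals,
  hence killed by all long paths.  Apply to a nonzero element of [K] at a frozen
  vertex a longest path to a frozen vertex [j] that does not kill it.  The result
  [y] is killed by every nontrivial path from [j] to a frozen vertex.  The Jacobian
  algebra of the subquiver on [mu_with fr j] is the quotient of the full one by the
  other frozen vertices ([jac_of_restr]), so [y] is the image of the generator of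
  [Emod j] under a nonzero map to [K] ([from_E]).

  The case of a cokernel is dual, with elements replaced by linear functionals
  ([to_Estar]), but these must be continuous.  Their existence is the analytic
  point: the image of a map between sums of projectives is closed ([im_closed]),
  because spaces of formal series are linearly compact ([affine_compactness]), and
  therefore a nonzero element of the cokernel is detected by a continuous
  functional ([coker_functional]). *)

(** * Subspaces, functionals and linear compactness *)

Section LinearMaps.
Variables (k : fieldType) (V W : lmodType k) (f : V -> W).
Hypothesis lf : linear f.

Lemma lin0 : f 0 = 0.
Proof. by have := lf (-1) 0 0; rewrite !scaleN1r !addNr. Qed.

Lemma linD x y : f (x + y) = f x + f y.
Proof. by have := lf 1 x y; rewrite !scale1r. Qed.

Lemma linZ c x : f (c *: x) = c *: f x.
Proof. by have := lf c x 0; rewrite lin0 !addr0. Qed.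

Lemma linB x y : f (x - y) = f x - f y.
Proof. by rewrite -!scaleN1r linD linZ. Qed.

Lemma lin_sum (I : finType) (F : I -> V) : f (\sum_i F i) = \sum_i f (F i).
Proof. by apply: (big_morph f linD lin0). Qed.

Fact lin_ker_mem c x y : f x = 0 -> f y = 0 -> f (c *: x + y) = 0.
Proof. by move=> fx fy; rewrite lf fx fy scaler0 addr0. Qed.

Definition lin_ker : subspace V := @Subspace k V (fun x => f x = 0) lin0 lin_ker_mem.
End LinearMaps.

Section Subspaces.
Variables (k : fieldType) (V : lmodType k).
Implicit Types N W : subspace V.

Lemma smemZ N c x : N x -> N (c *: x).
Proof. by move=> Nx; rewrite -[_ *: _]addr0; apply: smemP => //; exact: smem0. Qed.

Lemma smemD N x y : N x -> N y -> N (x + y).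
Proof. by move=> Nx Ny; rewrite -[x]scale1r; exact: smemP. Qed.

Lemma smemN N x : N x -> N (- x).
Proof. by rewrite -scaleN1r; exact: smemZ. Qed.

Lemma smemB N x y : N x -> N y -> N (x - y).
Proof. by move=> Nx /smemN; exact: smemD. Qed.

Lemma smem_sum N (I : finType) (F : I -> V) :
  (forall i, N (F i)) -> N (\sum_i F i).
Proof. by move=> NF; apply: big_ind => [|x y|//]; [exact: smem0|exact: smemD]. Qed.

Definition add_line_mem N x y := exists c : k, N (y - c *: x).

Fact add_line0 N x : add_line_mem N x 0.
Proof. by exists 0; rewrite scale0r subr0; exact: smem0. Qed.

Fact add_line_lin N x c y z :
  add_line_mem N x y -> add_line_mem N x z -> add_line_mem N x (c *: y + z).
Proof.
move=> [a Na] [b Nb]; exists (c * a + b).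
have -> : c *: y + z - (c * a + b) *: x = c *: (y - a *: x) + (z - b *: x).
  by rewrite scalerBr scalerDl scalerA opprD addrACA.
exact: smemP.
Qed.

Definition add_line N x : subspace V := Subspace (add_line0 N x) (@add_line_lin N x).

(** A subspace that is maximal among those containing [W] and avoiding [b] is
  a complement of the line spanned by [b]; the functional is the coordinate
  along that line. *)
Lemma separating_functional W b : ~ W b ->
  exists xi : V -> k^o, [/\ linear xi, forall w, W w -> xi w = 0 & xi b = 1].
Proof.
move=> Wb.
pose T := {N : subspace V | (forall w, W w -> N w) /\ ~ N b}.
pose R (M N : T) := `[< forall x, sval M x -> sval N x >].
have t0 : T by exists W.
have [||A totA|[N [WN Nb]] maxN] := @classical_sets.ZL_preorder T t0 R.
- by move=> t; apply/asboolP.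
- by move=> r s t /asboolP rs /asboolP st; apply/asboolP => x /rs /st.
- have [[s As]|A0] := pselect (exists s, A s); last first.
    by exists t0 => s As; case: A0; exists s.
  have U0 : exists2 s, A s & sval s 0 by exists s => //; exact: smem0.
  have UP c x y : (exists2 s, A s & sval s x) -> (exists2 s, A s & sval s y) ->
      exists2 s, A s & sval s (c *: x + y).
    move=> [s1 A1 x1] [s2 A2 y2]; have [/asboolP h|/asboolP h] := totA _ _ A1 A2.
      by exists s2 => //; apply: smemP => //; exact: h.
    by exists s1 => //; apply: smemP => //; exact: h.
  pose U := @Subspace k V (fun x => exists2 s, A s & sval s x) U0 UP.
  have WU : (forall w, W w -> U w) /\ ~ U b.
    split=> [w Ww|[t _]]; last by case: (svalP t).
    by exists s => //; case: (svalP s) => + _; exact.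
  by exists (exist _ _ WU : T) => t At; apply/asboolP => x tx; exists t.
have span x : exists c, N (x - c *: b).
  have [Nx|Nx] := pselect (N x); first by exists 0; rewrite scale0r subr0.
  have [[c Nc]|nb] := pselect (add_line N x b); last first.
    have WL : (forall w, W w -> add_line N x w) /\ ~ add_line N x b.
      by split=> // w /WN Nw; exists 0; rewrite scale0r subr0.
    have /asboolP /(_ x) : R (exist _ _ WL : T)
        (exist (fun N' : subspace V => _) N (conj WN Nb) : T).
      apply: maxN; apply/asboolP => y Ny.
      by exists 0; rewrite scale0r subr0.
    by move=> h; case: Nx; apply: h; exists 1; rewrite scale1r subrr; exact: smem0.
  have c0 : c != 0.
    by apply/eqP => c0; apply: (Nb); move: Nc; rewrite c0 scale0r subr0.
  exists c^-1; rewrite -opprB; apply: smemN.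
  have -> : c^-1 *: b - x = c^-1 *: (b - c *: x).
    by rewrite scalerBr scalerA mulVf ?scale1r.
  exact: smemZ.
have uniq_coef x c c' : N (x - c *: b) -> N (x - c' *: b) -> c = c'.
  move=> h h'; apply/eqP; rewrite -subr_eq0; apply: contrapT => /negP cc'; apply: (Nb).
  have -> : b = (c - c')^-1 *: ((x - c' *: b) - (x - c *: b)).
    rewrite opprB [X in _ *: X]addrC addrA subrK -scalerBl scalerA mulVf ?scale1r //.
  by apply: smemZ; exact: smemB.
have [xi Nxi] := choice span; exists xi; split.
- move=> c x y; apply: (uniq_coef (c *: x + y)); first exact: Nxi.
  have -> : c *: x + y - (c * xi x + xi y) *: b =
      c *: (x - xi x *: b) + (y - xi y *: b).
    by rewrite scalerBr scalerDl scalerA opprD addrACA.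
  exact: smemP.
- by move=> w /WN Nw; apply: (uniq_coef w) => //; rewrite scale0r subr0.
- by apply: (uniq_coef b) => //; rewrite scale1r subrr; exact: smem0.
Qed.
End Subspaces.

Section ImageSubspace.
Variables (k : fieldType) (V W : lmodType k) (f : V -> W) (lf : linear f).
Variable N : subspace V.

Fact image0 : exists2 z, N z & 0 = f z.
Proof. by exists 0; [exact: smem0|rewrite (lin0 lf)]. Qed.

Fact image_lin c x y : (exists2 z, N z & x = f z) -> (exists2 z, N z & y = f z) ->
  exists2 z, N z & c *: x + y = f z.
Proof.
by move=> [z Nz ->] [t Nt ->]; exists (c *: z + t); [exact: smemP|rewrite lf].
Qed.

Definition smem_image : subspace W :=
  @Subspace k W (fun x => exists2 z, N z & x = f z) image0 image_lin.
End ImageSubspace.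

(** Linear compactness of a countable product of lines.  The coordinates are
  chosen one at a time: once the first [n] of them are fixed, the values allowed
  for the next one at the levels 0, 1, 2, and so on form a decreasing sequence
  of nonempty affine subspaces of the line [k].  Either one of them is a point,
  and then so are all the later ones, with the same point, or all of them are
  the whole line; in both cases some value is allowed at every level. *)
Lemma affine_compactness (k : fieldType) (I : countType)
    (A : nat -> (I -> k^o) -> Prop) :
  (forall n c f g, A n f -> A n g -> A n (c *: f + (1 - c) *: g)) ->
  (forall n f, A n.+1 f -> A n f) ->
  (forall n, exists f, A n f) ->
  (forall n, exists N, forall f g, (forall i, (pickle i < N)%N -> f i = g i) ->
    A n f -> A n g) ->
  exists f, forall n, A n f.
Proof.
move=> affA decA neA finA.
have dec m n f : (m <= n)%N -> A n f -> A m f.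
  move=> /subnK <-; elim: (n - m)%N => // l IH; rewrite addSn => /decA; exact: IH.
pose fits N (h : nat -> k^o) (f : I -> k^o) :=
  forall i, (pickle i < N)%N -> f i = h (pickle i).
pose good N h := forall n, exists2 f, A n f & fits N h f.
have step N h : good N h -> exists x, good N.+1 (fun j => if (j < N)%N then h j else x).
  move=> gh.
  have [[i iN]|noi] := pselect (exists i : I, pickle i = N); last first.
    exists 0 => n; have [f Af fh] := gh n; exists f => // i.
    rewrite ltnS leq_eqVlt => /orP[/eqP iN|iN]; first by case: noi; exists i.
    by rewrite iN fh.
  pose val n x := exists f, [/\ A n f, fits N h f & f i = x].
  have fitS n x : val n x ->
      exists2 f, A n f & fits N.+1 (fun j => if (j < N)%N then h j else x) f.
    move=> [f [Af fh fi]]; exists f => // j; rewrite ltnS leq_eqVlt.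
    case/orP=> [/eqP jN|jN]; last by rewrite jN fh.
    rewrite jN ltnn -fi; congr (f _); apply: (pcan_inj (@pickleK I)).
    by rewrite jN iN.
  have [[n0 [x [[f0 [A0 h0 fx]] single]]]|many] :=
      pselect (exists n x, val n x /\ forall y, val n y -> y = x).
    exists x => n; apply: fitS; have [f Af fh] := gh (maxn n n0); exists f.
    have e : f i = x.
      by apply: single; exists f; split=> //; apply: dec Af; exact: leq_maxr.
    by split=> //; apply: dec Af; exact: leq_maxl.
  (* Every level allows two values, hence by affine combination also 0. *)
  exists 0 => n; apply: fitS; have [f Af fh] := gh n.
  have [[g Ag [gh' ne]]|eq] :=
      pselect (exists2 g, A n g & fits N h g /\ f i <> g i); last first.
    case: many; exists n, (f i); split; first by exists f.
    move=> y [g [Ag gh' <-]]; apply: contrapT => ne; case: eq; exists g => //.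
    by split=> // e; case: ne.
  have d0 : g i - f i != 0 by rewrite subr_eq0; apply/eqP => e; exact: ne.
  pose c := g i / (g i - f i); exists (c *: f + (1 - c) *: g); split.
  - exact: affA.
  - move=> j jN; rewrite -[LHS]/(c * f j + (1 - c) * g j) (fh j jN) (gh' j jN).
    by rewrite -mulrDl addrC subrK mul1r.
  - rewrite -[LHS]/(c * f i + (1 - c) * g i).
    have -> : 1 - c = - f i / (g i - f i).
      by rewrite -{1}(divff d0) -mulrBl addrAC subrr sub0r.
    by rewrite ![_ / _ * _]mulrAC -mulrDl mulNr [g i * _]mulrC addrN mul0r.
pose next N (h : nat -> k^o) (x : k^o) := good N h ->
  good N.+1 (fun j => if (j < N)%N then h j else x).
have next_ex N h : exists x, next N h x.
  have [/step[x gx]|ngh] := pselect (good N h); first by exists x.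
  by exists 0.
have [nxt nxtP] := choice (fun Nh : nat * (nat -> k^o) => next_ex Nh.1 Nh.2).
pose ext N h := fun j => if (j < N)%N then h j else nxt (N, h).
(* The coordinates of index at least [N] of [H N] are not chosen yet. *)
pose H := fix H N := if N is N'.+1 then ext N' (H N') else (fun=> 0).
have goodH N : good N (H N).
  elim: N => [|N IH] n; first by have [f Af] := neA n; exists f.
  exact: (nxtP (N, H N)).
have Hstable M N j : (j < M)%N -> (M <= N)%N -> H N j = H M j.
  move=> jM /subnK <-; elim: (N - M)%N => // l IH.
  by rewrite addSn /= /ext (leq_trans jM (leq_addl _ _)).
exists (fun i => H (pickle i).+1 (pickle i)) => n.
have [N finN] := finA n; have [f Af fH] := goodH N n.
by apply: finN Af => i iN; rewrite fH // (Hstable (pickle i).+1).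
Qed.

(** * Paths and truncations *)

Section Paths.
Variables (k : fieldType) (V : finType) (Q : quiver V).
Implicit Types (X : {set V}) (u v x : V) (w : seq Q).

Lemma is_pathW X u v w : is_path X u v w -> is_path [set: V] u v w.
Proof. by rewrite is_pathT => /andP[]. Qed.

Lemma coef_restr X Y u v (f : cpath k Q Y u v) w :
  is_path X u v w -> coef (restr f : cpath k Q X u v) w = coef f w.
Proof. by move=> pw; rewrite coef_path. Qed.

(** The inner [restr] goes from [X] to the larger set of all vertices, where it
  is extension by zero. *)
Lemma restrK X u v (f : cpath k Q X u v) :
  restr (restr f : cpath k Q [set: V] u v) = f.
Proof.
by apply/funext => p; rewrite {1}/restr coef_restr ?coef_val //; exact: is_pathW (valP p).
Qed.

Lemma restrB X Y u v (f g : cpath k Q Y u v) :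
  restr (f - g) = restr f - restr g :> cpath k Q X u v.
Proof. exact: linB (@restr_lin k V Q X Y u v) f g. Qed.

Definition pth X u v w : cpath k Q X u v := fun p => (val p == w)%:R.
Arguments pth : clear implicits.

Lemma pth_nil u : pth [set: V] u u [::] = cone [set: V] u.
Proof. by apply/funext => -[[|a w] pw]. Qed.

Lemma coef_pth X u v w w' :
  is_path X u v w -> coef (pth X u v w) w' = (w' == w)%:R.
Proof.
move=> pw; rewrite /coef; case: insubP => [p _ <-|np]; first by [].
by case: eqP np => // ->; rewrite pw.
Qed.

Lemma cmul_pth X u x v w1 w2 : is_path X u x w1 -> is_path X x v w2 ->
  cmul (pth X u x w1) (pth X x v w2) = pth X u v (w1 ++ w2).
Proof.
move=> p1 p2; apply/funext => -[w pw]; rewrite /cmul /conv /pth /=.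
under eq_bigr => t _ do rewrite !coef_pth // -natrM mulnb.
have [->|ne] := eqVneq w (w1 ++ w2); last first.
  rewrite big1 // => t _; case: eqP => //= e1; case: eqP => //= e2.
  by rewrite -e1 -e2 cat_take_drop eqxx in ne.
have lt1 : (size w1 < (size (w1 ++ w2)).+1)%N by rewrite ltnS size_cat leq_addr.
rewrite (bigD1 (Ordinal lt1)) //= take_size_cat // drop_size_cat // !eqxx.
rewrite big1 ?addr0 // => t ne1; case: eqP => //= e1; case/eqP: ne1.
apply: val_inj; rewrite /= -[in RHS]e1 size_takel //.
by rewrite -ltnS.
Qed.

Lemma path_leaves X u v w : is_path [set: V] u v w -> ~~ is_path X u v w ->
  exists x w1 w2, [/\ x \notin X, w = w1 ++ w2,
    is_path [set: V] u x w1 & is_path [set: V] x v w2].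
Proof.
elim: w u => [|a w IH] u.
  move=> pw npw; exists u, [::], [::]; split=> //=; last by rewrite in_setT eqxx.
  by move: pw npw => /= /andP[_ ->]; rewrite andbT.
have [uX|uX] := boolP (u \in X); last first.
  by move=> pw _; exists u, [::], (a :: w); split=> //=; rewrite in_setT eqxx.
rewrite /= in_setT uX /= => /andP[au pw]; rewrite au => npw.
have [x [w1 [w2 [xX -> p1 p2]]]] := IH _ pw npw.
by exists x, (a :: w1), w2; split=> //=; rewrite in_setT au.
Qed.

(** There are finitely many paths of each length, so the truncation of [f] is a
  finite combination of paths. *)
Lemma truncation X u v n (N : subspace (cpath k Q X u v)) (f : cpath k Q X u v) :
  (forall p, f p != 0 -> N (pth X u v (val p))) ->
  exists2 g, N g & agree_below n f g.
Proof.
move=> fN; pose T := {l : 'I_n & l.-tuple Q}.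
exists (\sum_(t : T) coef f (val (tagged t)) *: pth X u v (val (tagged t))).
  apply: smem_sum => t; rewrite /coef; case: insubP => [p _ <-|_].
    have [->|f0] := eqVneq (f p) 0; first by rewrite scale0r; exact: smem0.
    by apply: smemZ; exact: fN.
  by rewrite scale0r; exact: smem0.
move=> p pn.
have evalE (g : T -> cpath k Q X u v) : (\sum_t g t) p = \sum_t g t p.
  by apply: (big_morph (fun h : cpath k Q X u v => h p)).
pose t0 : T := Tagged (fun l : 'I_n => l.-tuple Q) (in_tuple (val p) : (Ordinal pn).-tuple Q).
rewrite evalE (bigD1 t0) //= big1 ?addr0.
  rewrite -[RHS]/(coef f (val p) * pth X u v (val p) p).
  by rewrite coef_val /pth eqxx mulr1.
case=> l t ne; rewrite -[LHS]/(_ * pth X u v t p) /pth.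
case: eqP => [e|_]; last by rewrite mulr0.
case/eqP: ne; rewrite /t0.
have el : l = Ordinal pn by apply: val_inj; rewrite /= e size_tuple.
subst l; congr existT; apply: val_inj; exact: esym e.
Qed.

Lemma agree_belowW X u v m n (f g : cpath k Q X u v) :
  (m <= n)%N -> agree_below n f g -> agree_below m f g.
Proof. by move=> mn fg p pm; apply: fg; exact: leq_trans mn. Qed.

Lemma agree_below_sub X u v n (f g : cpath k Q X u v) :
  agree_below n f g -> agree_below n (f - g) 0.
Proof. by move=> fg p pn; rewrite -[LHS]/(f p - g p) fg ?subrr. Qed.

Lemma cmul_high_l X u x v n (f : cpath k Q X u x) (g : cpath k Q X x v) :
  agree_below n f 0 -> agree_below n (cmul f g) 0.
Proof. by move=> f0; rewrite -(@cmul0l _ _ _ X u x v g); exact: agree_cmul. Qed.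

Lemma cmul_high_r X u x v n (f : cpath k Q X u x) (g : cpath k Q X x v) :
  agree_below n g 0 -> agree_below n (cmul f g) 0.
Proof. by move=> g0; rewrite -(@cmul0r _ _ _ X u x v f); exact: agree_cmul. Qed.

(** The Jacobian algebra of the full subquiver on [X] is the quotient of the
  Jacobian algebra of [Q] by the vertices outside [X]: the derivatives at
  arrows of [Q] restrict to those of the subquiver, and up to terms of high
  order only finitely many paths are discarded.  So an open subspace containing
  the Jacobian ideal and the paths that leave [X] contains all the series whose
  restriction to [X] lies in the Jacobian ideal of the subquiver. *)
Lemma jac_of_restr X (S : potential k Q) u v n
    (N : subspace (cpath k Q [set: V] u v)) (f : cpath k Q [set: V] u v) :
  (forall g, jac_alg S g -> N g) ->
  (forall g, agree_below n g 0 -> N g) ->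
  (forall w, is_path [set: V] u v w -> ~~ is_path X u v w -> N (pth [set: V] u v w)) ->
  jac X S u v (restr f) -> N f.
Proof.
move=> jN oN pN /(_ n)[g jg fg].
have [g' jg' eg] : exists2 g' : cpath k Q [set: V] u v, jac_alg S g' & restr g' = g.
  elim: jg => [|g1 g2 _ [h1 j1 <-] _ [h2 j2 <-]|a x y].
  - by exists 0; [exact: Jac0|rewrite -(subrr 0) restrB subrr].
  - exists (h1 + h2); first exact: JacD.
    exact: linD (@restr_lin k V Q X [set: V] u v) h1 h2.
  exists (cmul (cmul (restr x) (cderiv [set: V] S a)) (restr y)); first exact: JacM.
  rewrite !restr_cmul !restrK; congr (cmul (cmul _ _) _).
  by apply/funext => -[w pw]; rewrite /restr coef_path //= (is_pathW pw).
have : N (f - g').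
  (* [h] is the part of [f - g'] supported on the paths that leave [X]. *)
  pose h : cpath k Q [set: V] u v := fun p => if is_path X u v (val p) then 0 else (f - g') p.
  have [h' Nh' hh'] : exists2 h', N h' & agree_below n h h'.
    apply: truncation => p; rewrite /h; case: ifP => [|/negbT np _]; first by rewrite eqxx.
    by apply: pN => //; exact: (valP p).
  have -> : f - g' = (f - g' - h) + (h - h') + h' by rewrite addrA !subrK.
  apply: smemD => //; apply: smemD; apply: oN; last exact: agree_below_sub.
  move=> p pn; rewrite -[LHS]/((f - g') p - h p) /h.
  case: ifP => [pX|_]; last by rewrite subrr.
  rewrite subr0 -[LHS]/(f p - g' p).
  move: (fg (Sub (val p) pX) pn); rewrite -eg /restr /= !coef_val => ->.
  by rewrite subrr.
by move/smemD => /(_ _ (jN _ jg')); rewrite subrK.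
Qed.
End Paths.
Arguments pth {k V Q} X u v w.

(** * Homomorphisms to and from the boundary modules *)

Section Boundary.
Variables (k : fieldType) (V : finType) (Q : quiver V) (fr : {set V}).
Variable S : potential k Q.
Implicit Types M : jmod [set: V] S.

Lemma mu_withN j x : x \notin mu_with fr j -> x \in fr /\ x != j.
Proof. by rewrite !inE negb_or negbK => /andP[]. Qed.

Lemma fun_act_lin M u v (m : M u) : linear (fun f : cpath k Q [set: V] u v => act f m).
Proof. by move=> c f g; exact: act_linl. Qed.

Lemma act0 M u v (f : cpath k Q [set: V] u v) : act f (0 : M u) = 0.
Proof. exact: lin0 (@act_linear _ _ _ _ _ M u v f). Qed.

Lemma act_pth_cat M u x v w1 w2 (m : M u) :
  is_path [set: V] u x w1 -> is_path [set: V] x v w2 ->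
  act (pth [set: V] u v (w1 ++ w2)) m =
  act (pth [set: V] x v w2) (act (pth [set: V] u x w1) m).
Proof. by move=> p1 p2; rewrite -act_mul cmul_pth. Qed.

Lemma act_jac_alg M u v (f : cpath k Q [set: V] u v) (m : M u) :
  jac_alg S f -> act f m = 0.
Proof. by move=> jf; apply: act_jac => n; exists f. Qed.

Lemma pth_high u v n w : (n <= size w)%N -> agree_below n (pth [set: V] u v w : cpath k Q _ u v) 0.
Proof.
move=> nw p pn; rewrite /pth; case: eqP => // e.
by move: pn; rewrite e ltnNge nw.
Qed.

(** Every nonzero submodule of [Emod_star i] meets its component at [i]: if a
  functional is nonzero on the class of a series, then the action of this
  series sends it to a functional that is nonzero on the idempotent at [i]. *)
Lemma hom_Emod_star_zero M i : (forall m : M i, m = 0) -> hom_zero M (Emod_star fr S i).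
Proof.
move=> M0 h u m; apply: val_inj; apply/funext => q.
have hm0 (g : cpath k Q (mu_with fr i) u i) : inj_act g (h u m) = 0.
  have <- : act (restr g : cpath k Q [set: V] u i) (h u m) = inj_act g (h u m).
    by rewrite -[LHS]/(inj_act (restr (restr g)) (h u m)) restrK.
  by rewrite -hact (M0 (act _ _)) (lin0 (@hlinear _ _ _ _ _ _ _ h i)).
have -> : q = ljact (rep q) (toq (jac (mu_with fr i) S i i) (cone (mu_with fr i) i)).
  by rewrite ljactE cmul1r; exact/esym/toqK.
by have /(congr1 (fun xi => subsp_val xi (toq _ (cone (mu_with fr i) i)))) := hm0 (rep q).
Qed.

(** [Emod i] is generated by the idempotent at [i]. *)
Lemma hom_Emod_zero M i : (forall m : M i, m = 0) -> hom_zero (Emod fr S i) M.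
Proof.
move=> M0 h u q.
have -> : q = act (restr (rep q) : cpath k Q [set: V] i u)
    (toq _ (cone (mu_with fr i) i) : Emod fr S i i).
  rewrite -[RHS]/(jact (toq _ _) (restr (restr (rep q)))) restrK jactE cmul1l.
  by rewrite toqK.
by rewrite hact (M0 (h i _)) act0.
Qed.

Section FromE.
Variables (M : jmod [set: V] S) (j : V) (y : M j) (n : nat).
Hypothesis y_high : forall v (g : cpath k Q [set: V] j v), agree_below n g 0 -> act g y = 0.
Hypothesis y_socle : forall l w, l \in fr -> is_path [set: V] j l w -> w != [::] ->
  act (pth [set: V] j l w) y = 0.

Let X := mu_with fr j.

Lemma act_socle_restr v (f : cpath k Q [set: V] j v) : jac X S j v (restr f) -> act f y = 0.
Proof.
apply: (@jac_of_restr _ _ _ X S j v n (lin_ker (@fun_act_lin M j v y)) f).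
- by move=> g; exact: act_jac_alg.
- exact: y_high.
move=> w pw npw /=; have [l [w1 [w2 [/mu_withN[lfr lj] -> p1 p2]]]] := path_leaves pw npw.
rewrite (act_pth_cat _ p1 p2) y_socle ?act0 //.
by case: w1 p1 => //= /andP[_ /eqP jl]; rewrite jl eqxx in lj.
Qed.

Definition from_E_fun v (q : Emod fr S j v) : M v := act (restr (rep q)) y.

Lemma from_E_toq v (g : cpath k Q [set: V] j v) :
  from_E_fun (toq (jac X S j v) (restr g)) = act g y.
Proof.
apply/eqP; rewrite -subr_eq0; apply/eqP.
rewrite -(linB (@fun_act_lin M j v y)); apply: act_socle_restr.
by rewrite restrB restrK; exact: jac_rep.
Qed.

Fact from_E_linear v : linear (@from_E_fun v).
Proof.
move=> c p q.
have -> : c *: p + q = toq (jac X S j v) (restr (c *: restr (rep p) + restr (rep q) :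
    cpath k Q [set: V] j v)).
  by rewrite restr_lin !restrK toq_lin !toqK.
by rewrite from_E_toq act_linl.
Qed.

Fact from_E_act u v (f : cpath k Q [set: V] u v) (q : Emod fr S j u) :
  from_E_fun (act f q) = act f (from_E_fun q).
Proof.
have -> : act f q = toq (jac X S j v) (restr (cmul (restr (rep q)) f)).
  by rewrite restr_cmul restrK.
by rewrite from_E_toq act_mul.
Qed.

(** The map sends the idempotent at [j] to [y]; it is defined on [Emod j]
  because [y] is killed by the paths that leave [mu_with fr j]. *)
Definition from_E : jhom (Emod fr S j) M := JHom from_E_linear from_E_act.

Lemma socle_zero : hom_zero (Emod fr S j) M -> y = 0.
Proof.
move=> /(_ from_E j (toq _ (restr (cone [set: V] j)))) <-.
by rewrite [RHS]from_E_toq act_one.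
Qed.
End FromE.

Section ToEstar.
Variables (M : jmod [set: V] S) (j : V) (eta : M j -> k^o) (n : nat).
Hypothesis eta_lin : linear eta.
Hypothesis eta_high : forall v (g : cpath k Q [set: V] v j) m, agree_below n g 0 ->
  eta (act g m) = 0.
Hypothesis eta_top : forall l w m, l \in fr -> is_path [set: V] l j w -> w != [::] ->
  eta (act (pth [set: V] l j w) m) = 0.

Let X := mu_with fr j.

Lemma eta_act_lin v (m : M v) : linear (fun f : cpath k Q [set: V] v j => eta (act f m)).
Proof. by move=> c f g; rewrite act_linl eta_lin. Qed.

Lemma eta_restr v (f : cpath k Q [set: V] v j) m :
  jac X S v j (restr f) -> eta (act f m) = 0.
Proof.
apply: (@jac_of_restr _ _ _ X S v j n (lin_ker (@eta_act_lin v m)) f).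
- by move=> g jg; rewrite /= act_jac_alg // (lin0 eta_lin).
- by move=> g; exact: eta_high.
move=> w pw npw /=; have [l [w1 [w2 [/mu_withN[lfr lj] -> p1 p2]]]] := path_leaves pw npw.
rewrite (act_pth_cat _ p1 p2) eta_top //.
by case: w2 p2 => //= /andP[_ /eqP jl]; rewrite jl eqxx in lj.
Qed.

Definition to_Estar_val v (m : M v) (q : Jac X S v j) : k^o := eta (act (restr (rep q)) m).

Lemma to_Estar_toq v (m : M v) (g : cpath k Q [set: V] v j) :
  to_Estar_val m (toq (jac X S v j) (restr g)) = eta (act g m).
Proof.
apply/eqP; rewrite -subr_eq0; apply/eqP.
rewrite -(linB (@eta_act_lin v m)); apply: eta_restr.
by rewrite restrB restrK; exact: jac_rep.
Qed.

Fact to_Estar_mem v (m : M v) : to_Estar_val m \in smemb (cdual X S v j).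
Proof.
apply/asboolP; split.
  move=> c p q.
  have -> : c *: p + q = toq (jac X S v j) (restr (c *: restr (rep p) + restr (rep q) :
      cpath k Q [set: V] v j)).
    by rewrite restr_lin !restrK toq_lin !toqK.
  by rewrite to_Estar_toq act_linl eta_lin.
exists n => g g0; rewrite -[g]restrK to_Estar_toq; apply: eta_high => p pn.
rewrite /restr /coef; case: insubP => // p' _ e.
by apply: g0; rewrite e.
Qed.

Definition to_Estar_fun v (m : M v) : Emod_star fr S j v := SubSp (to_Estar_mem m).

Fact to_Estar_linear v : linear (@to_Estar_fun v).
Proof.
move=> c m m'; apply: val_inj; apply/funext => q.
rewrite -[LHS]/(eta (act (restr (rep q)) (c *: m + m'))).
by rewrite act_linear eta_lin.
Qed.

Fact to_Estar_act u v (f : cpath k Q [set: V] u v) (m : M u) :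
  to_Estar_fun (act f m) = act f (to_Estar_fun m).
Proof.
apply: val_inj; apply/funext => q.
rewrite -[LHS]/(eta (act (restr (rep q)) (act f m))) -act_mul.
rewrite -[RHS]/(to_Estar_val m (ljact (restr f) q)).
have -> : ljact (restr f) q = toq (jac X S u j) (restr (cmul f (restr (rep q)))).
  by rewrite restr_cmul restrK.
by rewrite to_Estar_toq.
Qed.

(** Composition with [eta] pairs an element of [M] with the series from its
  vertex to [j]; this descends to the subquiver on [mu_with fr j] because
  [eta] kills the image of the paths that leave it. *)
Definition to_Estar : jhom M (Emod_star fr S j) := JHom to_Estar_linear to_Estar_act.

Lemma top_zero : hom_zero M (Emod_star fr S j) -> forall m, eta m = 0.
Proof.
move=> h0 m; have := h0 to_Estar j m.
move=> /(congr1 (fun xi => subsp_val xi (toq _ (restr (cone [set: V] j))))).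
by rewrite [LHS]to_Estar_toq act_one.
Qed.
End ToEstar.

(** The socle of the frozen part of a locally nilpotent module: among the
  frozen paths that do not kill a given element, a longest one sends it to an
  element killed by all nontrivial frozen paths. *)
Lemma supported_of_hom_Emod M :
  (forall u (y : M u), exists n, forall v (g : cpath k Q [set: V] u v),
     agree_below n g 0 -> act g y = 0) ->
  (forall i, i \in fr -> hom_zero (Emod fr S i) M) -> supported_on_mu fr M.
Proof.
move=> nilM h0 i ifr y; have [n y_high] := nilM i y.
apply: contrapT => y0.
pose P l := `[< exists j w, [/\ j \in fr, is_path [set: V] i j w, size w = l &
                act (pth [set: V] i j w) y <> 0] >].
have exP : exists l, P l.
  exists 0%N; apply/asboolP; exists i, [::].
  by rewrite pth_nil act_one /= finset.in_setT eqxx.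
have ubP l : P l -> (l <= n)%N.
  move=> /asboolP[j [w [_ _ <- yw]]]; rewrite leqNgt; apply/negP => nw.
  by apply: yw; apply: y_high; exact: pth_high (ltnW nw).
case: (ex_maxnP exP ubP) => l /asboolP[j [w [jfr pw sw yw]]] maxl.
have [n' z_high] := nilM j (act (pth [set: V] i j w) y).
apply: yw; apply: (socle_zero z_high); last exact: h0.
move=> x w' xfr pw' w'0; rewrite -act_pth_cat //; apply: contrapT => yww'.
have /maxl : P (size (w ++ w')).
  by apply/asboolP; exists x, (w ++ w'); split=> //; exact: is_path_cat pw'.
by rewrite size_cat sw -{2}[l]addn0 leq_add2l leqn0 size_eq0 (negbTE w'0).
Qed.

(** The same argument on functionals: composing one with the longest frozen path
  that does not make it zero gives a functional that vanishes on the images of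
  all nontrivial frozen paths, hence a map to a boundary module. *)
Lemma supported_of_hom_Emod_star M :
  (forall i (m : M i), m <> 0 -> exists (xi : M i -> k^o) n, [/\ linear xi, xi m <> 0 &
     forall v (g : cpath k Q [set: V] v i) m', agree_below n g 0 -> xi (act g m') = 0]) ->
  (forall i, i \in fr -> hom_zero M (Emod_star fr S i)) -> supported_on_mu fr M.
Proof.
move=> sepM h0 i ifr m; apply: contrapT => /sepM[xi [n [lxi xim xi_high]]].
pose P l := `[< exists j w m', [/\ j \in fr, is_path [set: V] j i w, size w = l &
                xi (act (pth [set: V] j i w) m') <> 0] >].
have exP : exists l, P l.
  exists 0%N; apply/asboolP; exists i, [::], m.
  by rewrite pth_nil act_one /= finset.in_setT eqxx.
have ubP l : P l -> (l <= n)%N.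
  move=> /asboolP[j [w [m' [_ _ <- xiw]]]]; rewrite leqNgt; apply/negP => nw.
  by apply: xiw; apply: xi_high; exact: pth_high (ltnW nw).
case: (ex_maxnP exP ubP) => l /asboolP[j [w [m' [jfr pw sw xiw]]]] maxl.
apply: xiw; apply: (@top_zero M j (fun m => xi (act (pth [set: V] j i w) m)) n) (h0 j jfr) m'.
- by move=> c x y; rewrite act_linear lxi.
- move=> v g z g0; rewrite -act_mul; apply: xi_high.
  exact: cmul_high_l.
move=> x w' z xfr pw' w'0; rewrite -act_pth_cat //; apply: contrapT => xiww'.
have /maxl : P (size (w' ++ w)).
  by apply/asboolP; exists x, (w' ++ w), z; split=> //; exact: is_path_cat pw.
by rewrite size_cat sw -{2}[l]add0n leq_add2r leqn0 size_eq0 (negbTE w'0).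
Qed.
End Boundary.

(** * Kernels between injectives and cokernels between projectives *)

Section InjProj.
Variables (k : fieldType) (V : finType) (Q : quiver V).
Variables (X : {set V}) (S : potential k Q).

Lemma dsum_inj_nilpotent (I : finType) (s : I -> V) u
    (y : dsum (fun i => inj_mod X S (s i)) u) :
  exists n, forall v (g : cpath k Q X u v), agree_below n g 0 -> act g y = 0.
Proof.
have [n nP] := choice (fun i => (cdualP (y i)).2).
exists (\max_i n i)%N => v g g0; apply/functional_extensionality_dep => i.
apply: val_inj; apply/funext => q.
apply: (nP i); apply: cmul_high_l; apply: agree_belowW g0.
exact: leq_bigmax.
Qed.

Section Proj.
Variables (I : finType) (s : I -> V).
Let P := dsum (fun i => proj_mod X S (s i)).

(** The classes of the series of order at least [n]; these subspaces are a basis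
  of neighbourhoods of zero. *)
Definition high_mem n v (m : P v) :=
  forall i, exists2 g, agree_below n g 0 & m i = toq (jac X S (s i) v) g.

Fact high0 n v : high_mem n (0 : P v).
Proof. by move=> i; exists 0 => //; apply/esym; apply: toq0P; exact: jac0. Qed.

Fact high_lin n v c (x y : P v) : high_mem n x -> high_mem n y -> high_mem n (c *: x + y).
Proof.
move=> hx hy i; have [f f0 xf] := hx i; have [g g0 yg] := hy i.
exists (c *: f + g); last first.
  by rewrite -[LHS]/(c *: x i + y i) xf yg toq_lin.
by move=> p pn; rewrite -[LHS]/(c * f p + g p) f0 // g0 // mulr0 addr0.
Qed.

Definition high n v : subspace (P v) := Subspace (@high0 n v) (@high_lin n v).

Lemma highW m n v (x : P v) : (m <= n)%N -> high n v x -> high m v x.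
Proof. by move=> mn hx i; have [g g0 xg] := hx i; exists g => //; exact: agree_belowW g0. Qed.

Lemma high_act_r n u v (m : P u) (g : cpath k Q X u v) :
  agree_below n g 0 -> high n v (act g m).
Proof. by move=> g0 i; exists (cmul (rep (m i)) g) => //; exact: cmul_high_r. Qed.

(** This holds because the Jacobian ideal is closed. *)
Lemma high_separated v (m : P v) : (forall n, high n v m) -> m = 0.
Proof.
move=> hm; apply/functional_extensionality_dep => i.
have -> : m i = toq (jac X S (s i) v) (rep (m i)) by exact/esym/toqK.
apply: toq0P => n.
have [g g0 mg] := hm n i.
have jm : jac_mem S (rep (m i) - g) by rewrite mg; exact: jac_rep.
have [h jh e] := jm n.
by exists h => // p pn; rewrite -e // -[RHS]/(rep _ p - g p) g0 // subr0.
Qed.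
End Proj.
Arguments high {I s} n v.

Section Maps.
Variables (I J : finType) (s : I -> V) (t : J -> V).
Let P1 := dsum (fun i => proj_mod X S (s i)).
Let P0 := dsum (fun j => proj_mod X S (t j)).
Variable d : jhom P1 P0.

Definition proj_gen (i : I) : P1 (s i) :=
  dfwith (fun j => 0 : Jac X S (s j) (s i)) (toq (jac X S (s i) (s i)) (cone X (s i))).

Lemma proj_gen_sum v (m : P1 v) (g : forall i, cpath k Q X (s i) v) :
  (forall i, m i = toq (jac X S (s i) v) (g i)) -> m = \sum_i act (g i) (proj_gen i).
Proof.
move=> mg; apply/functional_extensionality_dep => i.
have evalE (h : I -> P1 v) : (\sum_l h l) i = \sum_l h l i.
  by apply: (big_morph (fun x : P1 v => x i)).
rewrite evalE (bigD1 i) //= big1 ?addr0 => [|l li].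
  rewrite -[RHS]/(jact (proj_gen i i) (g i)) /proj_gen dfwith_in jactE cmul1l.
  exact: mg.
rewrite -[LHS]/(jact (proj_gen l i) (g l)) /proj_gen dfwith_out //.
exact: lin0 (@proj_linear _ _ _ _ _ _ _ _ (g l)).
Qed.

(** Continuity is automatic: [d] is determined by the images of the idempotents,
  and acting by a series of order at least [n] raises the order to [n]. *)
Lemma high_hom n v (m : P1 v) : high n v m -> high n v (d v m).
Proof.
move=> hm; rewrite (proj_gen_sum (fun i => s2valP' (cid2 (hm i)))).
rewrite (lin_sum (@hlinear _ _ _ _ _ _ _ d v)).
apply: smem_sum => i; rewrite hact; apply: high_act_r.
exact: s2valP (cid2 (hm i)).
Qed.

(** Coefficients are given on all words, also on those that are not paths, so
  that a family of series is a function on a countable type. *)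
Definition lift v (F : I * seq Q -> k^o) : P1 v :=
  fun i => toq (jac X S (s i) v) (fun p => F (i, val p)).

Lemma lift_onto v (m : P1 v) : exists F, lift v F = m.
Proof.
exists (fun iw => coef (rep (m iw.1)) iw.2).
apply/functional_extensionality_dep => i; rewrite -[RHS]toqK /lift.
by congr toq; apply/funext => p; rewrite coef_val.
Qed.

Lemma lift_lin v : linear (@lift v).
Proof.
by move=> c F G; apply/functional_extensionality_dep => i; exact: toq_lin.
Qed.

(** The elements whose image approximates [b] to order [n] form an affine
  subspace that is determined by finitely many coefficients, so by compactness
  one element approximates [b] to all orders. *)
Lemma im_closed v (b : P0 v) :
  (forall n, exists m, high n v (b - d v m)) -> exists m, b = d v m.
Proof.
move=> approx; have dlin := @hlinear _ _ _ _ _ _ _ d v.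
have [||||F AF] := @affine_compactness k (I * seq Q)%type
    (fun n F => high n v (b - d v (lift v F))).
- move=> n c f g Af Ag.
  have -> : b - d v (lift v (c *: f + (1 - c) *: g)) =
      c *: (b - d v (lift v f)) + (1 - c) *: (b - d v (lift v g)).
    rewrite lift_lin (linZ (@lift_lin v)) dlin (linZ dlin) !scalerBr addrACA.
    by rewrite -scalerDl [c + _]addrC subrK scale1r opprD.
  by apply: smemP => //; exact: smemZ.
- by move=> n f; exact: highW.
- by move=> n; have [m hm] := approx n; have [F FE] := lift_onto m; exists F; rewrite FE.
- move=> n.
  (* This number exceeds the codes of all words of length less than [n]. *)
  exists (\max_(i : I) \max_(l : 'I_n) \max_(w : l.-tuple Q) (pickle (i, val w)).+1)%N.
  move=> f g fg Af.
  have -> : b - d v (lift v g) = (b - d v (lift v f)) + d v (lift v f - lift v g).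
    by rewrite (linB dlin) addrA subrK.
  apply: smemD => //; apply: high_hom; rewrite /= => i.
  exists (fun p => f (i, val p) - g (i, val p)); last first.
    by rewrite -(linB (@lift_lin v)).
  move=> p pn; rewrite fg ?subrr //.
  apply: leq_trans (leq_bigmax i); apply: leq_trans (leq_bigmax (Ordinal pn)).
  exact: leq_trans (leq_bigmax (in_tuple (val p))).
exists (lift v F); apply/eqP; rewrite -subr_eq0; apply/eqP.
exact: high_separated.
Qed.

(** A representative [b] of [m] lies outside the image of [d], which is closed,
  so the sum of this image and the elements of some order [n] still avoids [b];
  a functional that vanishes on this sum and not at [b] is continuous. *)
Lemma coker_functional i (m : coker d i) : m <> 0 ->
  exists (xi : coker d i -> k^o) n, [/\ linear xi, xi m <> 0 &
    forall v (g : cpath k Q X v i) m', agree_below n g 0 -> xi (act g m') = 0].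
Proof.
move=> m0; have [b mb] : exists b, m = toq (im d i) b by exists (rep m); exact/esym/toqK.
have [n nb] : exists n, forall x, ~ high n i (b - d i x).
  apply: contrapT => nn; case: m0; rewrite mb.
  have [x ->] : exists x, b = d i x.
    apply: im_closed => n; apply: contrapT => nx; apply: nn; exists n => x hx.
    by apply: nx; exists x.
  have <- : toq (im d i) 0 = 0 by exact: lin0 (@toq_lin _ _ (im d i)).
  by apply/toqE; exists x; rewrite subr0.
have dlin := @hlinear _ _ _ _ _ _ _ d i.
pose W := smem_image (@toq_lin _ _ (im d i)) (high n i).
have Wm : ~ W m.
  move=> [z hz]; rewrite mb => /toqE[x bz]; apply: (nb x).
  by rewrite -bz opprB addrC subrK.
have [xi [lxi W0 xim]] := separating_functional Wm.
exists xi, n; split=> //; first by rewrite xim; exact/eqP/oner_neq0.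
move=> v g m' g0; apply: W0; exists (act g (rep m' : P0 v)) => //.
exact: high_act_r.
Qed.
End Maps.
End InjProj.

(** * General properties *)

Section General.
Variables (k : fieldType) (V : finType) (Q : quiver V).
Variables (X : {set V}) (S : potential k Q) (M N : jmod X S).
Variable F : forall v, (N v -> k^o) -> Prop.

Lemma dense_openT : dense_open (M := M) F (fun=> True).
Proof.
split=> [d _|W _ [d Wd]]; last by exists d.
by exists (fun=> 1); split=> //; [exact: RegC|exact/eqP/oner_neq0].
Qed.

Lemma dense_openI (A B : jhom M N -> Prop) :
  dense_open F A -> dense_open F B -> dense_open F (fun d => A d /\ B d).
Proof.
have zopenI (C D : jhom M N -> Prop) : zopen F C -> zopen F D -> zopen F (fun d => C d /\ D d).
  move=> oC oD d [Cd Dd]; have [f [rf f0 fC]] := oC d Cd; have [g [rg g0 gD]] := oD d Dd.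
  exists (fun d => f d * g d); split; first exact: RegM.
    by apply/eqP; rewrite mulf_neq0 //; exact/eqP.
  move=> d' /eqP; rewrite mulf_eq0 negb_or => /andP[/eqP fd' /eqP gd'].
  by split; [exact: fC|exact: gD].
move=> [oA dA] [oB dB]; split; first exact: zopenI.
move=> W oW neW; have [d Bd Wd] := dB W oW neW.
have [d' Ad' [Bd' Wd']] := dA _ (zopenI _ _ oB oW) (ex_intro _ d (conj Bd Wd)).
by exists d'.
Qed.

Lemma general_sub (A B : jhom M N -> Prop) :
  (forall d, A d -> B d) -> general F A -> general F B.
Proof. by move=> AB [U oU UA]; exists U => // d /UA /AB. Qed.

Lemma general_forall (I : finType) (C : {set I}) (A : I -> jhom M N -> Prop) :
  (forall i, i \in C -> general F (A i)) -> general F (fun d => forall i, i \in C -> A i d).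
Proof.
move=> gA.
have [U oU UA] : general F (fun d => forall i, i \in enum C -> A i d).
  have: {subset enum C <= C} by move=> i; rewrite mem_enum.
  elim: (enum C) => [|i r IH] rC; first by exists (fun=> True); first exact: dense_openT.
  have [|U oU UA] := IH; first by move=> j jr; apply: rC; rewrite inE jr orbT.
  have [|U' oU' UA'] := gA i; first by apply: rC; rewrite inE eqxx.
  exists (fun d => U d /\ U' d); first exact: dense_openI.
  by move=> d [/UA h /UA' h'] j; rewrite inE => /orP[/eqP ->|/h].
by exists U => // d Ud i iC; apply: UA => //; rewrite mem_enum.
Qed.
End General.

(** * The criterion *)

Section Criterion.
Variables (k : fieldType) (V : finType) (Q : quiver V) (fr : {set V}).
Variable S : potential k Q.

Lemma supported_coker_proj (I J : finType) (s : I -> V) (t : J -> V)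
    (d : jhom (dsum (fun i => proj_mod [set: V] S (s i)))
              (dsum (fun j => proj_mod [set: V] S (t j)))) :
  supported_on_mu fr (coker d) <->
  forall i, i \in fr -> hom_zero (coker d) (Emod_star fr S i).
Proof.
split=> [sd i ifr|]; first by apply: hom_Emod_star_zero; exact: sd.
by apply: supported_of_hom_Emod_star; exact: coker_functional.
Qed.

Lemma supported_ker_inj (I J : finType) (s : I -> V) (t : J -> V)
    (d : jhom (dsum (fun i => inj_mod [set: V] S (s i)))
              (dsum (fun j => inj_mod [set: V] S (t j)))) :
  supported_on_mu fr (ker d) <->
  forall i, i \in fr -> hom_zero (Emod fr S i) (ker d).
Proof.
split=> [sd i ifr|]; first by apply: hom_Emod_zero; exact: sd.
apply: supported_of_hom_Emod => u y.
have [n yn] := dsum_inj_nilpotent (subsp_val y).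
by exists n => v g /yn gy; apply: val_inj.
Qed.
End Criterion.

(* "d_i is general" is the generic quantifier over the presentations d_i of
   weight -b_i of the mutable part (Q, Smu): the dense open subsets U_i depend
   only on (Q, Smu), and the assertion holds for every S extending Smu whose
   presentations d_i lie in the U_i. *)
Theorem theorem5p17 (k : closedFieldType) (hk : [pchar k] =i pred0)
    (V : finType) (Q : quiver V) (fr : {set V}) (hQ : loopless Q)
    (Smu : potential k Q) :
  exists U : forall i, PHom (mu fr) Smu (opp_vec (bcol Q fr i)) -> Prop,
    (forall i, i \in fr -> dense_openP (U i)) /\
    forall S : potential k Q,
      cyc_equiv (mu fr) S Smu ->
      nondegenerate_qp fr (QP S) ->
      (forall i, i \in fr -> simple_frozen fr S i) ->
      (forall i, i \in fr -> exists2 d, is_frozen_pres S d & U i d) ->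
      frozen_Jacobi_finite fr S ->
      (forall delta : V -> int,
         mu_supported fr S delta <->
         forall i, i \in fr -> hom_delta_zero delta (Emod_star fr S i)) /\
      (forall delta : V -> int,
         mu_supported_check fr S delta <->
         forall i, i \in fr -> hom_check_zero (Emod fr S i) delta).
Proof.
(* The equivalences hold for each single presentation, so the open sets are
  the whole spaces. *)
exists (fun _ _ => True); split=> [i _|S _ _ _ _ _]; first exact: dense_openT.
split=> delta; split.
- move=> gd i ifr; apply: general_sub gd => d /supported_coker_proj; exact.
- by move=> /general_forall; apply: general_sub => d /supported_coker_proj.
- move=> gd i ifr; apply: general_sub gd => d /supported_ker_inj; exact.
- by move=> /general_forall; apply: general_sub => d /supported_ker_inj.
Qed.
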